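(* Let $k\ge1$ and let $\bar X^{(1)},\dots,\bar X^{(k)}$ be homogeneous Markov chains with time indexed by $t\ge0$ and countable state spaces $A_1,\dots,A_k$ respectively. Suppose that for a homogeneous Markov chain $\bar Z$ with countable state space $C$ and maps $f_i:A_i\to C$, $$\bigl(f_i(\bar X^{(i)}_t)\bigr)_{t\ge0}\overset{d}{=}\bar Z\quad\text{for all } i=1,\dots,k.$$ Then there exists a homogeneous Markov chain $(X^{(1)}_t,\dots,X^{(k)}_t)_{t\ge0}$ such that $(X^{(i)}_t)_{t\ge0}\overset{d}{=}\bar X^{(i)}$ for all $i$, and $f_i(X^{(i)}_t)=f_j(X^{(j)}_t)$ for all $i,j$ and all $t\ge0$. Moreover, writing $Z_t=f_1(X^{(1)}_t)=\dots=f_k(X^{(k)}_t)$ (so that $Z=(Z_t)_{t\ge 0}\overset{d}{=}\bar Z$), the chain may be chosen so that, in addition, the marginal processes $X^{(1)},\dots,X^{(k)}$ are conditionally independent given $Z$.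
   Context: A Markov chain is regarded as a stochastic process with a specified initial distribution as well as its transition probabilities; $\overset{d}{=}$ denotes equality in law of processes. *)

(* Defs.v *)
From HB Require Import structures.
From mathcomp Require Import all_boot all_order all_algebra.
From mathcomp Require Import all_classical all_reals all_analysis.

Set Implicit Arguments.
Unset Strict Implicit.
Unset Printing Implicit Defensive.

Import Order.TTheory GRing.Theory Num.Theory.
Local Open Scope classical_set_scope.
Local Open Scope ring_scope.

(* Time is discrete: a process with state space [A] is [X : nat -> Omega -> A].
   State spaces are [countType]s carrying the discrete sigma-algebra. *)
Definition process d (Omega : measurableType d) (A : countType)
    (X : nat -> Omega -> A) : Prop :=
  forall (t : nat) (D : set A), measurable (X t @^-1` D).

Definition trajectory (Omega A : Type) (X : nat -> Omega -> A) (w : Omega) :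
  nat -> A := fun t => X t w.

Definition path_sigma (A : Type) : set (set (nat -> A)) :=
  <<s [set B | exists (t : nat) (D : set A), B = [set x | D (x t)]] >>.

Definition eq_law (R : realType) (A : Type)
    d (Omega : measurableType d) (P : probability Omega R)
    d' (Omega' : measurableType d') (P' : probability Omega' R)
    (X : nat -> Omega -> A) (X' : nat -> Omega' -> A) : Prop :=
  forall B : set (nat -> A), path_sigma B ->
    P (trajectory X @^-1` B) = P' (trajectory X' @^-1` B).

Definition cprob (R : realType) d (Omega : measurableType d)
    (P : probability Omega R) (E F : set Omega) : R :=
  fine (P (E `&` F)) / fine (P F).

Definition distribution_on (R : realType) (A : countType) (m : A -> R) : Prop :=
  (forall a, 0 <= m a) /\ (\esum_(a in [set: A]) (m a)%:E = 1)%E.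

Definition history (Omega A : Type) (X : nat -> Omega -> A) (n : nat)
    (x : nat -> A) : set Omega :=
  [set w | forall m, (m <= n)%N -> X m w = x m].

(* The rows of [p] at states that are never visited are constrained only by
   being probability distributions. *)
Definition markov_chain (R : realType) d (Omega : measurableType d)
    (P : probability Omega R) (A : countType) (X : nat -> Omega -> A)
    (mu : A -> R) (p : A -> A -> R) : Prop :=
  [/\ process X,
      distribution_on mu,
      forall a, distribution_on (p a),
      forall a, fine (P (X 0%N @^-1` [set a])) = mu a &
      forall (n : nat) (x : nat -> A) (y : A), P (history X n x) != 0%E ->
        cprob P (X n.+1 @^-1` [set y]) (history X n x) = p (x n) y].

Definition homogeneous_markov_chain (R : realType) d (Omega : measurableType d)
    (P : probability Omega R) (A : countType) (X : nat -> Omega -> A) : Prop :=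
  exists (mu : A -> R) (p : A -> A -> R), markov_chain P X mu p.

Definition sigma_of (Omega A : Type) (Z : nat -> Omega -> A) :
    set (set Omega) :=
  preimage_set_system setT (trajectory Z) (@path_sigma A).

(* [g] is a version of the conditional probability of [E] given the
   sub-sigma-algebra [G]. *)
Definition is_cond_prob (R : realType) d (Omega : measurableType d)
    (P : probability Omega R) (G : set (set Omega)) (E : set Omega)
    (g : Omega -> R) : Prop :=
  [/\ forall Y : set R, measurable Y -> G (g @^-1` Y),
      P.-integrable setT (EFin \o g) &
      forall D, G D -> (\int[P]_(w in D) (g w)%:E = P (E `&` D))%E].

(* For all path events [B i],
   P(X i \in B i for all i | Z) = \prod_i P(X i \in B i | Z) almost surely.
   Versions are a.s. unique, so it does not matter which [g i] are used.
   Independence of subfamilies is the case where some [B i] are [setT]. *)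
Definition cond_independent (R : realType) d (Omega : measurableType d)
    (P : probability Omega R) (k : nat) (A : 'I_k -> countType)
    (X : forall i, nat -> Omega -> A i)
    (C : countType) (Z : nat -> Omega -> C) : Prop :=
  forall B : forall i, set (nat -> A i), (forall i, path_sigma (B i)) ->
    exists g : 'I_k -> Omega -> R,
      (forall i, is_cond_prob P (sigma_of Z) (trajectory (X i) @^-1` B i) (g i))
      /\ is_cond_prob P (sigma_of Z)
           (\bigcap_(i in [set: 'I_k]) trajectory (X i) @^-1` B i)
           (fun w => \prod_(i < k) g i w).

Definition joint (Omega : Type) (k : nat) (A : 'I_k -> countType)
    (X : forall i, nat -> Omega -> A i) :
    nat -> Omega -> {dffun forall i : 'I_k, A i} :=
  fun t w => [ffun i => X i t w].

(* Main.v *)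
Require Import Defs.
From HB Require Import structures.
From mathcomp Require Import all_boot all_order all_algebra.
From mathcomp Require Import all_classical all_reals all_analysis.
From mathcomp Require Import measurable_realfun lra.

Set Implicit Arguments.
Unset Strict Implicit.
Unset Printing Implicit Defensive.

Import Order.TTheory GRing.Theory Num.Theory.
Local Open Scope classical_set_scope.
Local Open Scope ring_scope.

(** Write [nu] for the law of [Zbar], [rho i] for the law of [Xbar i], and
    [phi_i(B)] for the conditional probability, as a function of the path of the
    image process, that the [i]-th chain has its path in [B].  In a coupling that
    is conditionally independent given the common image, the chains have paths in
    [B_1, ..., B_k] with probability

      coupling_mass B = \int \prod_i phi_i(B_i) dnu.

    These numbers determine the coupling, and they can be used to construct it:
    on tuples of cylinders they are consistent, so some process [Y] on the product
    of the state spaces realizes them ([process_of_fdd]).  The identity extends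
    from cylinders to arbitrary path events one coordinate at a time
    ([coupling_mass_unique], [component_law]), and then the marginal laws, the law
    of the common image and conditional independence are read off the formula.
    Tuples whose components have different images carry no mass, and [Y] visits
    only finite words of positive mass, so the images agree at every sample point.

    The point is that [Y] is a homogeneous Markov chain.  Its transition
    probabilities are not products of those of the components: the image of
    [Xbar i] is a Markov chain, but the probability of moving from a state [a]
    into a fibre of [f i] may depend on [a] and not only on [f i a].  Thus,
    given the past of the image, the past of a component may depend on the future
    of the image.  Fix a past of the [i]-th component that ends in [a], and let
    [z] be its image.  By the Markov property of [Xbar i] and of [Zbar], the law
    of the future of the image, both on this past of the component and on [z], is
    up to a constant a law given by the present state alone.  So [phi_i] of this
    past, as a function of the future of the image, is a constant times a function
    that depends on [a] only.  Hence

      coupling_mass (cyl w_1, ..., cyl w_k) =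
        (\prod_i rho i (cyl w_i)) nu(cyl z)^(1 - k) H(a_1, ..., a_k)

    for words [w_i] with last states [a_i] and common image word [z]; [H] is the
    integral of the product of these functions against the law of the future of
    the image given its present state.  The ratio of the masses before and after
    one more step therefore depends on the present states only
    ([mass_future_proportional], [word_mass_ratio]): the coupled chain is a Doob
    transform by [H]. *)

(** * Countable sums *)

(** [pickle] enumerates [E] injectively; the indices that it misses add [0]. *)
Lemma esum_pickle (R : realType) (E : countType) (a : E -> \bar R) :
  (forall x, 0 <= a x)%E ->
  (\esum_(x in [set: E]) a x = \sum_(j <oo) oapp a 0 (pickle_inv j))%E.
Proof.
move=> a0; rewrite nneseries_esumT; last by move=> j; case: pickle_inv => /=.
pose g j := oapp a 0%E (pickle_inv j).
have -> : (\esum_(j in setT) g j = \esum_(j in range (@pickle E)) g j)%E.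
  rewrite [RHS]esum_mkcond; apply: eq_esum => j _.
  case: ifPn => //; rewrite notin_setE /g => h.
  case E1 : (pickle_inv j) => [x|] //=; case: h; exists x => //.
  by have := @pickle_invK E j; rewrite E1.
rewrite (reindex_esum [set: E] _ pickle).
  by apply: eq_esum => x _; rewrite /g pickleK_inv.
split => [x _|x y _ _|//]; first by exists x.
exact: (pcan_inj pickleK_inv).
Qed.

Lemma measure_countable_bigcup (R : realType) d (T : measurableType d)
    (mu : {measure set T -> \bar R}) (E : countType) (F : E -> set T) :
  (forall x, measurable (F x)) -> trivIset setT F ->
  (mu (\bigcup_x F x) = \esum_(x in [set: E]) mu (F x))%E.
Proof.
move=> mF tF; rewrite esum_pickle; last by move=> x; exact: measure_ge0.
pose G j := oapp F set0 (pickle_inv j).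
have -> : \bigcup_x F x = \bigcup_j G j.
  apply/seteqP; split => [t [x _ Fxt]|t [j _]].
    by exists (pickle x) => //; rewrite /G pickleK_inv.
  by rewrite /G; case: pickle_inv => //= x Fxt; exists x.
rewrite measure_semi_bigcup//.
- apply: eq_eseriesr => j _; rewrite /G.
  by case: pickle_inv => //=; rewrite measure0.
- by move=> j; rewrite /G; case: pickle_inv => /=.
- move=> i j _ _; rewrite /G.
  have := @pickle_invK E i; have := @pickle_invK E j.
  case: pickle_inv => [x|] /= h; last by case: (pickle_inv i) => [y|] _ [? []].
  case: pickle_inv => [y|] /= h'; last by case=> ? [].
  by move/tF => yx; rewrite -h -h' yx.
- apply: bigcupT_measurable => j; rewrite /G.
  by case: pickle_inv => /=.
Qed.

Lemma countable_union_measurable d (T : measurableType d) (E : countType)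
    (P : set E) (F : E -> set T) :
  (forall x, P x -> measurable (F x)) -> measurable (\bigcup_(x in P) F x).
Proof.
move=> mF; rewrite bigcup_mkcond; apply: countable_bigcupT_measurable => // x.
by case: ifPn => // /set_mem; exact: mF.
Qed.

Lemma esumZl (R : realType) (E : countType) (a : E -> \bar R) (r : R) :
  (forall x, 0 <= a x)%E -> 0 <= r ->
  (\esum_(x in [set: E]) (r%:E * a x) = r%:E * \esum_(x in [set: E]) a x)%E.
Proof.
move=> a0 r0; rewrite !esum_pickle//; last by move=> x; rewrite mule_ge0.
rewrite -nneseriesZl//; last by move=> j _; case: pickle_inv => /=.
by apply: eq_eseriesr => j _; case: pickle_inv => //=; rewrite mule0.
Qed.

Lemma distribution_on_dirac (R : realType) (E : countType) (a : E) :
  distribution_on (fun x => (x == a)%:R : R).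
Proof.
split => [x|]; first exact: ler0n.
rewrite (_ : 1%E = \esum_(x in [set a]) ((x == a)%:R : R)%:E)%E; last first.
  by rewrite esum_set1 eqxx // lee_fin.
rewrite [RHS]esum_mkcond; apply: eq_esum => x _.
have [->|xa] := eqVneq x a; case: ifPn => //; rewrite ?inE// notin_setE /=.
by move=> /(_ erefl).
Qed.

(** Additivity in each coordinate separately gives additivity over tuples.  The
    coordinates are refined one at a time: after [l] steps the sum ranges over
    the tuples that agree with a base point [e0] from coordinate [l] on, which
    keeps the index type the same at every step. *)
Lemma esum_dffun (R : realType) (k : nat) (A : 'I_k -> countType)
    (V : 'I_k -> Type) (J : (forall i, V i) -> \bar R)
    (s : forall i, V i) (c : forall i, A i -> V i)
    (e0 : {dffun forall i : 'I_k, A i}) :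
  (forall B, 0 <= J B)%E ->
  (forall (l : 'I_k) B,
    J (dfwith B l (s l)) = \esum_(a in [set: A l]) J (dfwith B l (c l a)))%E ->
  (J s = \esum_(e in [set: {dffun forall i : 'I_k, A i}])
    J (fun i => c i (e i)))%E.
Proof.
move=> J0 Jsplit.
pose S l := [set e : {dffun forall i : 'I_k, A i} |
  forall i : 'I_k, (l <= i)%N -> e i = e0 i].
pose part l (e : {dffun forall i : 'I_k, A i}) : forall i, V i :=
  fun i => if (i < l)%N then c i (e i) else s i.
suff H l : (l <= k)%N -> (J s = \esum_(e in S l) J (part l e))%E.
  rewrite (H k)//; have -> : S k = setT.
    by apply/seteqP; split => // e _ i; rewrite leqNgt ltn_ord.
  apply: eq_esum => e _; congr J; apply: functional_extensionality_dep => i.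
  by rewrite /part ltn_ord.
elim: l => [_|l IH lk].
  have -> : S 0%N = [set e0].
    apply/seteqP; split => [e Se /=|e -> //].
    by apply/ffunP => i; apply: Se.
  by rewrite esum_set1.
rewrite IH ?(ltnW lk)//.
pose lo : 'I_k := Ordinal lk.
pose upd (ea : {dffun forall i : 'I_k, A i} * A lo) :
  {dffun forall i : 'I_k, A i} := [ffun i => dfwith ea.1 lo ea.2 i].
have updl ea : upd ea lo = ea.2 by rewrite /upd ffunE dfwithin.
have updn ea i : lo != i -> upd ea i = ea.1 i.
  by move=> li; rewrite /upd ffunE dfwithout.
have bij : set_bij (S l `*`` (fun=> setT)) (S l.+1) upd.
  split.
  - move=> [e a] [/= Se _] i li; rewrite updn /=; first by rewrite Se// ltnW.
    by apply/eqP => /(congr1 val) /= E; rewrite -E ltnn in li.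
  - move=> [e a] [e' a'] /set_mem [/= Se _] /set_mem [/= Se' _] eq.
    congr (_, _); last by rewrite -[a](updl (e, a)) eq updl.
    apply/ffunP => i; have [<-|li] := eqVneq lo i; first by rewrite Se ?Se'.
    by have := updn (e, a) _ li; rewrite eq updn.
  - move=> e Se; exists (upd (e, e0 lo), e lo).
      split => //= i li; have [<-|ni] := eqVneq lo i; first by rewrite updl.
      rewrite updn//= Se// ltn_neqAle li andbT.
      by apply: contra ni => /eqP li'; apply/eqP/val_inj.
    apply/ffunP => i; have [<-|li] := eqVneq lo i; first by rewrite updl.
    by rewrite updn//= updn.
rewrite (reindex_esum _ _ _ _ bij) -(@esum_esum _ _ _ (S l) (fun=> setT)
  (fun e a => J (part l.+1 (upd (e, a)))))//.
apply: eq_esum => e Se.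
have -> : part l e = dfwith (part l e) lo (s lo).
  apply: functional_extensionality_dep => i.
  by case: dfwithP => // ; rewrite /part ltnn.
rewrite Jsplit; apply: eq_esum => a _; apply: (congr1 J).
apply: functional_extensionality_dep => i.
case: dfwithP => [|j lj].
  by rewrite /part /= ltnS leqnn updl.
rewrite /part updn//= ltnS [(j <= l)%N]leq_eqVlt.
have [jl|//] := eqVneq (j : nat) l.
by move/eqP: lj; case; apply: val_inj; rewrite /= jl.
Qed.

(** * Words and cylinders *)

(** Prefixes are listed with the most recent state first, so that extending a
    path by one step is [cons]. *)
Fixpoint past (A : Type) (x : nat -> A) (n : nat) : seq A :=
  if n is n'.+1 then x n' :: past x n' else [::].

Definition cyl (A : Type) (w : seq A) : set (nat -> A) :=
  [set x | past x (size w) = w].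

Lemma size_past A (x : nat -> A) n : size (past x n) = n.
Proof. by elim: n => //= n ->. Qed.

Lemma past_eq A (x y : nat -> A) n :
  past x n = past y n <-> forall m, (m < n)%N -> x m = y m.
Proof.
elim: n => [|n IH] //=; split => [[xn /IH h] m|h].
  by rewrite ltnS leq_eqVlt => /orP[/eqP ->|/h].
by congr (_ :: _); [exact: h|apply/IH => m mn; apply: h; rewrite ltnS ltnW].
Qed.

Lemma cyl_past A (x : nat -> A) n : cyl (past x n) x.
Proof. by rewrite /cyl /= size_past. Qed.

Definition path_shift (A : Type) (n : nat) (x : nat -> A) : nat -> A :=
  fun t => x (t + n)%N.

Definition path_cons (A : Type) (a : A) (x : nat -> A) : nat -> A :=
  fun t => if t is t'.+1 then x t' else a.

(** An inverse of [path_shift] on a cylinder.  The head of [w] is its last state,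
    so it is the first one to be put in front of the future [y]. *)
Fixpoint graft (A : Type) (w : seq A) (y : nat -> A) : nat -> A :=
  if w is a :: w' then graft w' (path_cons a y) else y.

Definition path_fmap (A B : Type) (f : A -> B) (x : nat -> A) : nat -> B :=
  fun t => f (x t).

Section words.
Context (A : Type).
Implicit Types (w u : seq A) (x y : nat -> A).

Lemma cyl_nil : cyl (@nil A) = setT.
Proof. by apply/seteqP; split. Qed.

Lemma cyl_cons a w : cyl (a :: w) = cyl w `&` [set x | x (size w) = a].
Proof.
by apply/seteqP; split => x; rewrite /cyl /=; [case|case=> -> ->].
Qed.

Lemma past_add x m n :
  past x (m + n) = past (path_shift n x) m ++ past x n.
Proof. by elim: m => //= m ->. Qed.

Lemma cyl_cat u w : cyl (u ++ w) = cyl w `&` path_shift (size w) @^-1` cyl u.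
Proof.
apply/seteqP; split => x; rewrite /cyl /= size_cat past_add.
  move=> E; have := congr1 (take (size u)) E; have := congr1 (drop (size u)) E.
  by rewrite !drop_size_cat ?size_past// !take_size_cat ?size_past// => -> ->.
by case=> -> ->.
Qed.

Lemma path_shift_graft w y : path_shift (size w) (graft w y) = y.
Proof.
elim: w y => [|a w IH] y /=.
  by apply/funext => t; rewrite /path_shift addn0.
apply/funext => t; rewrite /path_shift addnS -addSn.
by have := congr1 (fun x => x t.+1) (IH (path_cons a y)).
Qed.

Lemma cyl_graft w y : cyl w (graft w y).
Proof.
elim: w y => [|a w IH] y; first by rewrite cyl_nil.
rewrite cyl_cons; split; first exact: IH.
by have := congr1 (fun x => x 0%N) (path_shift_graft w (path_cons a y)).
Qed.

Lemma graft_path_shift w x : cyl w x -> graft w (path_shift (size w) x) = x.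
Proof.
elim: w => [_|a w IH]; first by apply/funext => t; rewrite /= /path_shift addn0.
rewrite cyl_cons => -[wx /= xa] /=; rewrite -[RHS]IH//; congr graft.
by apply/funext => -[|t] /=; rewrite /path_shift // addnS addSn.
Qed.

End words.

Lemma past_map (A B : Type) (f : A -> B) x n :
  past (path_fmap f x) n = map f (past x n).
Proof. by elim: n => //= n ->. Qed.

Lemma cyl_map (A B : Type) (f : A -> B) w :
  cyl w `<=` path_fmap f @^-1` cyl (map f w).
Proof.
by move=> x; rewrite /cyl /= size_map past_map => ->.
Qed.

Lemma cyl_disjoint (A : Type) (w w' : seq A) :
  size w = size w' -> w <> w' -> cyl w `&` cyl w' = set0.
Proof.
move=> ss ww; apply/seteqP; split => // x [].
by rewrite /cyl /= ss => -> E; case: ww.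
Qed.

Lemma cyl_children (A : Type) (w : seq A) : cyl w = \bigcup_a cyl (a :: w).
Proof.
apply/seteqP; split => [x wx|x [a _]]; last by rewrite cyl_cons => -[].
by exists (x (size w)) => //; rewrite cyl_cons.
Qed.

Lemma trivIset_children (A : Type) (w : seq A) :
  trivIset setT (fun a => cyl (a :: w)).
Proof.
by move=> a b _ _ [x []]; rewrite !cyl_cons => -[_ /= ->] [_ /= ->].
Qed.

Section columns.
Context (k : nat) (A : 'I_k -> countType).
Local Notation E := {dffun forall i : 'I_k, A i}.

Definition column (w : seq E) (i : 'I_k) : seq (A i) :=
  map (fun e : E => e i) w.

Lemma size_column w i : size (column w i) = size w.
Proof. exact: size_map. Qed.

Lemma column_inj w w' : size w = size w' ->
  (forall i, column w i = column w' i) -> w = w'.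
Proof.
elim: w w' => [|e w IH] [|e' w'] //= [ss] cE; congr (_ :: _).
  by apply/ffunP => i; case: (cE i).
by apply: IH => // i; case: (cE i).
Qed.

Lemma word_of_columns (N : nat) (u : forall i, seq (A i)) :
  (forall i, size (u i) = N) -> (forall i, A i) ->
  exists w : seq E, size w = N /\ forall i, column w i = u i.
Proof.
move=> su e0.
exists (mkseq (fun t => [ffun i => nth (e0 i) (u i) t] : E) N).
split => [|i]; first by rewrite size_mkseq.
apply: (@eq_from_nth _ (e0 i)); rewrite size_column size_mkseq ?su// => t tN.
by rewrite /column -map_comp (nth_map 0%N) ?size_iota// nth_iota//= ffunE.
Qed.

End columns.

(** * Processes with prescribed word probabilities *)

(** Nested half-open intervals: the words of length [n] partition [0,1) into
    intervals of the prescribed lengths, and refining the word refines the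
    interval.  Following the intervals that contain a uniform point of [0,1)
    produces the process. *)
Section nested_intervals.
Context (R : realType) (E : countType) (m : seq E -> R).
Hypothesis m_ge0 : forall w, 0 <= m w.
Hypothesis m_nil : m [::] = 1.
Hypothesis m_sum : forall w,
  (\esum_(x in [set: E]) (m (x :: w))%:E = (m w)%:E)%E.

Let child_mass w j : R := oapp (fun x => m (x :: w)) 0 (pickle_inv j).
Let offset w n : R := \sum_(0 <= j < n) child_mass w j.

Fixpoint left_end (w : seq E) : R :=
  if w is x :: w' then left_end w' + offset w' (pickle x) else 0.

Definition cell (w : seq E) : set R := `[left_end w, left_end w + m w[%classic.

Let child_mass_ge0 w j : 0 <= child_mass w j.
Proof. by rewrite /child_mass; case: pickle_inv => /=. Qed.

Let child_mass_pickle w x : child_mass w (pickle x) = m (x :: w).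
Proof. by rewrite /child_mass pickleK_inv. Qed.

Let offsetS w n : offset w n.+1 = offset w n + child_mass w n.
Proof. by rewrite /offset big_nat_recr. Qed.

Let offset_ge0 w n : 0 <= offset w n.
Proof. by apply: sumr_ge0. Qed.

Let offset_le w n n' : (n <= n')%N -> offset w n <= offset w n'.
Proof.
move=> /subnK <-; elim: (n' - n)%N => // i IH.
by rewrite addSn offsetS (le_trans IH)// lerDl.
Qed.

Let series_child_mass w : (\sum_(j <oo) (child_mass w j)%:E = (m w)%:E)%E.
Proof.
rewrite -m_sum esum_pickle; last by move=> x; rewrite lee_fin.
by apply: eq_eseriesr => j _; rewrite /child_mass; case: pickle_inv.
Qed.

Let offset_le_m w n : offset w n <= m w.
Proof.
rewrite -lee_fin -series_child_mass /offset -sumEFin.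
by apply: nneseries_lim_ge => j _ _; rewrite lee_fin.
Qed.

Let offset_gt w r : r < m w -> exists n, r < offset w n.
Proof.
move=> rm; apply: contrapT => h; move: rm; apply/negP; rewrite -leNgt.
rewrite -lee_fin -series_child_mass; apply: lime_le.
  by apply: is_cvg_nneseries => j _ _; rewrite lee_fin.
apply: nearW => n; rewrite sumEFin lee_fin leNgt; apply/negP => rn.
by apply: h; exists n.
Qed.

Let cellP w u : cell w u <-> left_end w <= u < left_end w + m w.
Proof. by rewrite /cell /= in_itv. Qed.

Lemma cell_cons w x : cell (x :: w) `<=` cell w.
Proof.
move=> u /cellP /=; rewrite -child_mass_pickle => /andP[h1 h2]; apply/cellP.
have := offset_ge0 w (pickle x); have := offset_le_m w (pickle x).+1.
rewrite offsetS => *; apply/andP; split; lra.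
Qed.

Lemma cell_child w u : cell w u -> exists x, cell (x :: w) u.
Proof.
move=> /cellP /andP[h1 h2].
have [|n hn] := @offset_gt w (u - left_end w); first lra.
have ex : exists n, u - left_end w < offset w n by exists n.
(* The child containing [u] is the last one that starts at or before [u]: if
   [j.+1] is the least number of children that together exceed the distance
   from the left end to [u], it is the child numbered [j]. *)
case: (ex_minnP ex) => -[|j].
  by rewrite /offset big_nil => ? _; lra.
move=> hj minj.
have hj' : offset w j <= u - left_end w.
  by rewrite leNgt; apply/negP => /minj; rewrite ltnn.
rewrite offsetS in hj; move: hj; rewrite {1}/child_mass.
have := @pickle_invK E j; case: pickle_inv => /= [x|] jx; last by lra.
move=> hj; exists x; apply/cellP => /=; rewrite jx; apply/andP; split; lra.
Qed.

Lemma cell_uniq w w' u : size w = size w' -> cell w u -> cell w' u -> w = w'.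
Proof.
elim: w w' => [|x w IH] [|y w'] //= [ss] c c'.
have ww := IH _ ss (cell_cons c) (cell_cons c'); rewrite -ww in c' *.
congr (_ :: _); apply: (pcan_inj (@pickleK_inv E)).
have disj a b : (pickle a < pickle b)%N -> cell (a :: w) u -> cell (b :: w) u ->
    False.
  clear -offset_le offsetS child_mass_pickle cellP.
  move=> /(offset_le w); rewrite offsetS child_mass_pickle => ab.
  by move=> /cellP /andP[_ /= ?] /cellP /andP[/= ? _]; lra.
by case: (ltngtP (pickle x) (pickle y)) => // /disj h; exfalso; apply: h.
Qed.

Lemma cell_nil u : cell [::] u <-> 0 <= u < 1.
Proof. by rewrite cellP /= m_nil add0r. Qed.

Lemma cell_sub01 w u : cell w u -> 0 <= u < 1.
Proof. by elim: w => [/cell_nil//|x w IH] /cell_cons. Qed.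

Lemma cell_mass_gt0 w u : cell w u -> 0 < m w.
Proof. by move=> /cellP /andP[? ?]; lra. Qed.

Lemma cell_exists n u : 0 <= u < 1 -> exists w, size w = n /\ cell w u.
Proof.
move=> u01; elim: n => [|n [w [<- /cell_child[x xw]]]].
  by exists [::]; split => //; apply/cell_nil.
by exists (x :: w).
Qed.

Definition word_at (n : nat) (u : R) : seq E :=
  xget [::] [set w | size w = n /\ cell w u].

Lemma word_atP n u :
  0 <= u < 1 -> size (word_at n u) = n /\ cell (word_at n u) u.
Proof.
move=> /(cell_exists n) [w hw]; rewrite /word_at.
by case: xgetP => [? _ []//|/(_ w)[]].
Qed.

Lemma word_atE w u : 0 <= u < 1 -> word_at (size w) u = w <-> cell w u.
Proof.
move=> /(word_atP (size w)) [s c]; split=> [<- //|cw].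
exact: (cell_uniq s c cw).
Qed.

(** Points outside [0,1) lie in no interval; sending them to [0] makes the
    process follow the intervals everywhere, not only almost everywhere. *)
Definition to01 (u : R) : R := if 0 <= u < 1 then u else 0.

Lemma to01P u : 0 <= to01 u < 1.
Proof. by rewrite /to01; case: ifPn => // _; rewrite lexx ltr01. Qed.

Definition interval_process (e0 : E) (t : nat) (u : R) : E :=
  head e0 (word_at t.+1 (to01 u)).

Lemma past_interval_process e0 u n :
  past ((interval_process e0)^~ u) n = word_at n (to01 u).
Proof.
have h n' := word_atP n' (to01P u).
elim: n => [|n IH] /=.
  by have [/eqP] := h 0%N; rewrite size_eq0 => /eqP ->.
rewrite IH /interval_process; have [] := h n.+1; have [sn cn] := h n.
case: word_at => // x w [sw] /= /cell_cons cw; congr (_ :: _).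
by apply: cell_uniq cn cw; rewrite sn sw.
Qed.

Let U : probability (measurableTypeR R) R := uniform_prob (@ltr01 R).

Let measurable_cell w : measurable (cell w : set (measurableTypeR R)).
Proof. exact: measurable_itv. Qed.

Let uniform_cell w : U (cell w) = (m w)%:E.
Proof.
rewrite /U /= /uniform_prob.
rewrite (eq_integral (cst 1%E)).
  rewrite integral_cst; last exact: measurable_cell.
  rewrite mul1e [LHS]lebesgue_measure_itv /= lte_fin ltrDl.
  case: ifPn => [_|]; first by rewrite -EFinD addrC addKr.
  by rewrite -leNgt => h; congr EFin; apply/eqP; rewrite eq_le h m_ge0.
move=> u /set_mem /cell_sub01 /andP[h1 h2].
by rewrite /uniform_pdf h1 (ltW h2) /= subr0 invr1.
Qed.

Let preimage_to01 (S : set R) : to01 @^-1` S =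
  (S `&` cell [::]) `|` (if 0 \in S then ~` cell [::] else set0).
Proof.
apply/seteqP; split => u /=; rewrite /to01.
  case: ifPn => [u01 Su|nu01 S0]; first by left; split => //; apply/cell_nil.
  by right; rewrite mem_set//=; apply/cell_nil/negP.
case=> [[Su /cell_nil -> //]|].
by case: ifPn => // /set_mem S0 h; case: ifPn => // u01; case: h; apply/cell_nil.
Qed.

Lemma past_preimage e0 w :
  [set u | past ((interval_process e0)^~ u) (size w) = w] =
  to01 @^-1` cell w.
Proof.
apply/seteqP; split => u /=; rewrite past_interval_process.
  by move/word_atE; apply; exact: to01P.
by move=> c; apply/word_atE => //; exact: to01P.
Qed.

Lemma interval_process_fdd e0 w :
  measurable ([set u | past ((interval_process e0)^~ u) (size w) = w] :
    set (measurableTypeR R)) /\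
  U [set u | past ((interval_process e0)^~ u) (size w) = w] = (m w)%:E.
Proof.
rewrite past_preimage preimage_to01.
have -> : cell w `&` cell [::] = cell w.
  by rewrite setIidl// => u /cell_sub01 /cell_nil.
have mN : measurable (if 0 \in cell w then ~` cell [::] else set0 :
    set (measurableTypeR R)).
  by case: ifP => // _; apply: measurableC; exact: measurable_cell.
split; first exact: measurableU.
rewrite [LHS]measureU0; [exact: uniform_cell|exact: measurable_cell|exact: mN|].
case: ifP => _; last by rewrite measure0.
rewrite [LHS](probability_setC U (measurable_cell _)) uniform_cell m_nil.
by rewrite subee.
Qed.

End nested_intervals.

(** The last clause holds at every sample point because an interval of length
    [0] is empty; it turns almost sure constraints on the process into sure ones. *)
Lemma process_of_fdd (R : realType) (E : countType) (m : seq E -> R) :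
  (forall w, 0 <= m w) -> m [::] = 1 ->
  (forall w, \esum_(x in [set: E]) (m (x :: w))%:E = (m w)%:E)%E ->
  exists (d : measure_display) (Omega : measurableType d)
      (Q : probability Omega R) (X : nat -> Omega -> E),
    [/\ process X,
        forall w, Q [set u | cyl w (X^~ u)] = (m w)%:E &
        forall u n, 0 < m (past (X^~ u) n)].
Proof.
move=> m0 m1 mS.
have [e0 _] : exists e, cell m [:: e] 0.
  by apply: cell_child => //; apply/cell_nil; rewrite // lexx ltr01.
exists _, (measurableTypeR R), (uniform_prob (@ltr01 R)).
exists (interval_process m e0).
split => [t D|w|u n].
- have -> : interval_process m e0 t @^-1` D =
      \bigcup_(w in [set w | size w = t.+1 /\ D (head e0 w)])
        [set u | past ((interval_process m e0)^~ u) (size w) = w].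
    apply/seteqP; split => [u Du|u [w [sw Dw]] /=].
      exists (past ((interval_process m e0)^~ u) t.+1).
        by split; [exact: size_past|].
      by rewrite /= size_past.
    by rewrite sw => wE; rewrite -wE in Dw.
  apply: countable_union_measurable => w _.
  by have [] := interval_process_fdd m0 m1 mS e0 w.
- by have [] := interval_process_fdd m0 m1 mS e0 w.
- rewrite past_interval_process//.
  have [_] := word_atP m0 m1 mS n (to01P u).
  exact: cell_mass_gt0.
Qed.

(** * Densities of dominated measures *)

Lemma integrable_01 (R : realType) d (T : measurableType d)
    (mu : {finite_measure set T -> \bar R}) (g : T -> R) :
  measurable_fun setT g -> (forall x, 0 <= g x <= 1) ->
  mu.-integrable setT (EFin \o g).
Proof.
move=> mg g01; apply: measurable_bounded_integrable => //.
  by rewrite ltey_eq fin_num_measure.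
exists 1; split; first exact: num_real.
move=> M M1 x _; have /andP[g0 g1] := g01 x.
by rewrite /= ger0_norm// (le_trans g1 (ltW M1)).
Qed.

Section density.
Context (R : realType) d (T : measurableType d).
Variables nu al : {finite_measure set T -> \bar R}.
Hypothesis al_nu : forall D, measurable D -> (al D <= nu D)%E.

Let al_dom_nu : al `<< nu.
Proof.
apply/null_content_dominatesP => A mA nuA; apply/eqP.
by rewrite -measure_le0 -nuA; exact: al_nu.
Qed.

(** Truncating a Radon-Nikodym derivative at [1] does not change its integrals:
    on the set where it exceeds [1] both measures agree. *)
Lemma density_exists : exists phi : T -> R,
  [/\ measurable_fun setT phi, forall x, 0 <= phi x <= 1 &
      forall D, measurable D -> (al D = \int[nu]_(x in D) (phi x)%:E)%E].
Proof.
have [f [f0 ffin fint fE]] := radon_nikodym_sigma_finite al_dom_nu.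
have mf : measurable_fun setT f by exact: measurable_int fint.
pose E := [set x | (1 <= f x)%E].
have mE : measurable E.
  by rewrite -[E]setTI; exact: emeasurable_fun_c_infty.
pose phi x := Num.min (fine (f x)) 1.
have phiE x : (phi x)%:E = Order.min (f x) 1%E.
  by rewrite /phi EFin_min fineK.
have mphi : measurable_fun setT phi.
  by apply: measurable_minr => //; exact: measurableT_comp.
exists phi; split => // [x|D mD].
  by rewrite /phi ge_min lexx orbT andbT le_min ler01 fine_ge0.
have mDE := measurableI _ _ mD mE.
have mDCE := measurableD mD mE.
have split_int g : measurable_fun setT g -> (forall x, 0 <= g x)%E ->
    (\int[nu]_(x in D) g x =
     \int[nu]_(x in D `\` E) g x + \int[nu]_(x in D `&` E) g x)%E.
  move=> mg g0; rewrite -{1}(setUIDK D E) setUC ge0_integral_setU//.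
  - by rewrite setUC setUIDK; exact: measurable_funTS.
  - by apply/disj_set2P; rewrite setIC setDE setIACA setICr setI0.
have nuDE : (al (D `&` E) = nu (D `&` E))%E.
  apply/eqP; rewrite eq_le al_nu//= fE// -[leLHS]mul1e -integral_cst//.
  apply: ge0_le_integral => //; first exact: measurable_funTS.
  by move=> x [].
rewrite fE// (split_int f)// (split_int (EFin \o phi)); last 2 first.
- exact/measurable_EFinP.
- by move=> x; rewrite /= phiE le_min f0 lee01.
congr (_ + _)%E.
  apply: eq_integral => x /set_mem [_ /negP]; rewrite -ltNge => fx.
  by rewrite /= phiE min_l// ltW.
rewrite -fE// nuDE -[LHS]mul1e -integral_cst//; apply: eq_integral => x.
by move=> /set_mem [_ /= fx]; rewrite /= phiE min_r.
Qed.

(** Any such density agrees almost everywhere with a Radon-Nikodym derivative. *)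
Lemma density_change_of_variables (phi : T -> R) (G : T -> \bar R) :
  measurable_fun setT phi -> (forall x, 0 <= phi x <= 1) ->
  (forall D, measurable D -> (al D = \int[nu]_(x in D) (phi x)%:E)%E) ->
  measurable_fun setT G -> (forall x, 0 <= G x)%E ->
  (\int[nu]_x (G x * (phi x)%:E) = \int[al]_x G x)%E.
Proof.
move=> mphi phi01 phiE mG G0.
pose f := Radon_Nikodym_SigmaFinite.f al nu.
have fint : nu.-integrable setT f.
  exact: Radon_Nikodym_SigmaFinite.f_integrable.
have mf : measurable_fun setT f by exact: measurable_int fint.
rewrite -(Radon_Nikodym_SigmaFinite.change_of_variables al_dom_nu G0)//.
have mphi' : measurable_fun setT (EFin \o phi) by exact/measurable_EFinP.
apply: ae_eq_integral => //; [exact: emeasurable_funM|exact: emeasurable_funM|].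
have : ae_eq nu setT f (EFin \o phi).
  apply: integral_ae_eq => // D _ mD.
  by rewrite -Radon_Nikodym_SigmaFinite.f_integral// phiE.
by apply: filterS => x h Tx; rewrite -/f h.
Qed.

End density.

(** * Restricted image measures and measures with a density *)

Section image_restriction.
Context (R : realType) d (T : measurableType d) d' (S : measurableType d').
Variables (mu : {finite_measure set T -> \bar R}) (F : T -> S).
Hypothesis mF : measurable_fun setT F.

Lemma measurable_preimage D : measurable D -> measurable (F @^-1` D).
Proof. by move=> mD; rewrite -[_ @^-1` _]setTI; exact: mF. Qed.

Variable B : set T.
Hypothesis mB : measurable B.

(** The law of [F] on the event [B]; its density with respect to the law of [F]
    is the conditional probability of [B] given [F].  The measurability proofs
    are arguments so that the measure structure can be inferred. *)
Definition image_restr & measurable_fun setT F & measurable B :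
  set S -> \bar R := fun D => mu (B `&` F @^-1` D).

Local Notation la := (image_restr mF mB).

Let la0 : la set0 = 0%E.
Proof. by rewrite /image_restr preimage_set0 setI0 measure0. Qed.

Let la_ge0 D : (0 <= la D)%E.
Proof. exact: measure_ge0. Qed.

Let la_sigma_additive : semi_sigma_additive la.
Proof.
move=> G mG tG mUG; rewrite /image_restr preimage_bigcup setI_bigcupr.
apply: measure_semi_sigma_additive.
- by move=> n; apply: measurableI => //; exact: measurable_preimage.
- apply/trivIsetP => i j _ _ ij; rewrite setIACA setIid -preimage_setI.
  by move/trivIsetP : tG => /(_ _ _ I I ij) ->; rewrite preimage_set0 setI0.
- apply: bigcup_measurable => n _; apply: measurableI => //.
  exact: measurable_preimage.
Qed.

HB.instance Definition _ := isMeasure.Build _ _ _ la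
  la0 la_ge0 la_sigma_additive.

Let la_fin : fin_num_fun la.
Proof.
move=> D mD; apply: fin_num_measure; apply: measurableI => //.
exact: measurable_preimage.
Qed.

HB.instance Definition _ := Measure_isFinite.Build _ _ _ la la_fin.

Lemma integral_image_restr (G : S -> \bar R) D : measurable D ->
  measurable_fun setT G -> (forall z, 0 <= G z)%E ->
  (\int[la]_(z in D) G z = \int[mu]_(x in B `&` F @^-1` D) G (F x))%E.
Proof.
move=> mD mG G0.
rewrite (eq_measure_integral (pushforward (mrestr mu mB) F)); last first.
  by move=> A mA _; rewrite /= /image_restr /pushforward /mrestr setIC.
rewrite ge0_integral_pushforward//; last exact: measurable_funTS.
have mFD := measurable_preimage mD.
have mGF : measurable_fun setT (G \o F) by exact: measurableT_comp.
have mDB := measurableI _ _ mFD mB; have mDCB := measurableD mFD mB.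
rewrite -[in LHS](setUIDK (F @^-1` D) B) (ge0_integral_setU _ mDB mDCB)//.
- rewrite [X in (_ + X)%E](_ : _ = 0)%E ?adde0.
    rewrite [in RHS]setIC; apply: eq_measure_integral => A mA AB.
    by rewrite /= /mrestr setIidl// => x /AB [].
  apply: null_set_integral => //; first exact: measurable_funTS.
  by rewrite /= /mrestr setDE -setIA setICl setI0 measure0.
- exact: measurable_funTS.
- by move=> x _; exact: G0.
- by apply/disj_set2P; rewrite setDE setIACA setICr setI0.
Qed.

End image_restriction.

Section weighted_measure.
Context (R : realType) d (T : measurableType d).
Variables (mu : {measure set T -> \bar R}) (g : T -> \bar R).
Hypotheses (mg : measurable_fun setT g) (g0 : forall x, (0 <= g x)%E).

Definition weighted & measurable_fun setT g & (forall x, (0 <= g x)%E) :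
  set T -> \bar R := fun A => (\int[mu]_(x in A) g x)%E.

Local Notation la := (weighted mg g0).

Let la0 : la set0 = 0%E.
Proof. by rewrite /weighted integral_set0. Qed.

Let la_ge0 D : (0 <= la D)%E.
Proof. exact: integral_ge0. Qed.

Let la_sigma_additive : semi_sigma_additive la.
Proof.
move=> G mG tG mUG; rewrite /weighted.
rewrite ge0_integral_bigcup//; last exact: measurable_funTS.
by apply: is_cvg_nneseries => n _ _; exact: integral_ge0.
Qed.

HB.instance Definition _ := isMeasure.Build _ _ _ la
  la0 la_ge0 la_sigma_additive.

End weighted_measure.

(** * The conditionally independent coupling on rectangles *)

Section coupling_functional.
Context (R : realType) (k : nat) (d : 'I_k -> measure_display).
Context (T : forall i, measurableType (d i)).
Context (dS : measure_display) (S : measurableType dS).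
Variables (rho : forall i, probability (T i) R) (nu : probability S R).
Variable F : forall i, T i -> S.
Arguments F : clear implicits.
Hypothesis mF : forall i, measurable_fun setT (F i).
Hypothesis rhoF : forall i D, measurable D -> rho i (F i @^-1` D) = nu D.
Arguments mF : clear implicits.
Arguments rhoF : clear implicits.

Let rho_le i B (mB : measurable B) D : measurable D ->
  (image_restr (rho i) (mF i) mB D <= nu D)%E.
Proof.
move=> mD; rewrite -(rhoF i D mD) /image_restr.
have mFD := measurable_preimage (mF i) mD.
by apply: le_measure; rewrite ?inE//; exact: measurableI.
Qed.

(** A version of the conditional probability of [B], a set of values of the
    [i]-th variable, given the common image in [S]. *)
Definition cond_density i (B : set (T i)) : S -> R :=
  if pselect (measurable B) is left mB
  then sval (cid (density_exists (@rho_le i B mB))) else cst 0.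

Section one_coordinate.
Variables (i : 'I_k) (B : set (T i)).

Lemma cond_density_ge0 z : 0 <= cond_density B z.
Proof.
rewrite /cond_density; case: pselect => // mB.
by case: cid => phi /= [_ /(_ z) /andP[]].
Qed.

Lemma cond_density_le1 z : cond_density B z <= 1.
Proof.
rewrite /cond_density; case: pselect => // mB.
by case: cid => phi /= [_ /(_ z) /andP[]].
Qed.

Lemma measurable_cond_density : measurable_fun setT (cond_density B).
Proof.
rewrite /cond_density; case: pselect => // mB.
by case: cid => phi /= [].
Qed.

Hypothesis mB : measurable B.

Lemma integral_cond_density D : measurable D ->
  (\int[nu]_(z in D) (cond_density B z)%:E = rho i (B `&` F i @^-1` D))%E.
Proof.
move=> mD; rewrite /cond_density; case: pselect => // mB'.
by case: cid => phi /= [_ _ <-].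
Qed.

Lemma integral_mul_cond_density (G : S -> \bar R) :
  measurable_fun setT G -> (forall z, 0 <= G z)%E ->
  (\int[nu]_z (G z * (cond_density B z)%:E) = \int[rho i]_(x in B) G (F i x))%E.
Proof.
move=> mG G0.
rewrite (@density_change_of_variables _ _ _ nu
  (image_restr (rho i) (mF i) mB))//.
- by rewrite integral_image_restr// preimage_setT setIT.
- exact: rho_le.
- exact: measurable_cond_density.
- by move=> z; rewrite cond_density_ge0 cond_density_le1.
- by move=> D mD; rewrite integral_cond_density.
Qed.

End one_coordinate.

(** Given the common image, an event that it determines acts as a factor. *)
Lemma cond_density_setI_ae i (B : set (T i)) D : measurable B -> measurable D ->
  {ae nu, forall z, cond_density (B `&` F i @^-1` D) z =
                    cond_density B z * \1_D z}.
Proof.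
move=> mB mD; have mFD := measurable_preimage (mF i) mD.
have mBD := measurableI _ _ mB mFD.
have md := measurable_cond_density.
have mr : measurable_fun setT (fun z => cond_density B z * \1_D z).
  by apply: measurable_funM => //; exact: measurable_indic.
suff : ae_eq nu setT (EFin \o cond_density (B `&` F i @^-1` D))
    (fun z => (cond_density B z * \1_D z)%:E).
  by apply: filterS => z /(_ I) [].
apply: integral_ae_eq => //.
- apply: integrable_01 => // z.
  by rewrite cond_density_ge0 cond_density_le1.
- exact/measurable_EFinP.
move=> E _ mE; rewrite integral_cond_density// -setIA -preimage_setI.
rewrite -integral_cond_density//; last exact: measurableI.
rewrite setIC integral_mkcondr; apply: eq_integral => z _.
by rewrite epatch_indic.
Qed.

Lemma cond_density_setT_ae i : {ae nu, forall z, cond_density [set: T i] z = 1}.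
Proof.
have md := measurable_cond_density.
suff : ae_eq nu setT (EFin \o cond_density [set: T i]) (cst 1%E).
  by apply: filterS => z /(_ I) [].
apply: integral_ae_eq => //.
- apply: integrable_01 => // z.
  by rewrite cond_density_ge0 cond_density_le1.
move=> E _ mE; rewrite integral_cond_density// setTI rhoF//.
by rewrite integral_cst// mul1e.
Qed.

(** The probability of the rectangle with sides [B i] under the conditionally
    independent coupling. *)
Definition coupling_mass (B : forall i, set (T i)) : \bar R :=
  (\int[nu]_z (\prod_(i < k) cond_density (B i) z)%:E)%E.

Let measurable_prod_density (B : forall i, set (T i)) (P : pred 'I_k) :
  measurable_fun setT (fun z => \prod_(i < k | P i) cond_density (B i) z).
Proof.
under eq_fun do rewrite big_mkcond.
apply: (measurable_prod (s := index_enum _)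
  (h := fun i z => if P i then cond_density (B i) z else 1)) => i _.
case: (P i) => //.
exact: measurable_cond_density.
Qed.

Let prod_density_ge0 (B : forall i, set (T i)) (P : pred 'I_k) z :
  0 <= \prod_(i < k | P i) cond_density (B i) z.
Proof. by apply: prodr_ge0 => i _; exact: cond_density_ge0. Qed.

Let prod_density_le1 (B : forall i, set (T i)) (P : pred 'I_k) z :
  \prod_(i < k | P i) cond_density (B i) z <= 1.
Proof.
by apply: prodr_ile1 => i _; rewrite cond_density_ge0 cond_density_le1.
Qed.

Let prod_density_le (B : forall i, set (T i)) i z :
  \prod_(i < k) cond_density (B i) z <= cond_density (B i) z.
Proof. by rewrite (bigD1 i)//= ler_piMr ?cond_density_ge0. Qed.

Lemma coupling_mass_ge0 B : (0 <= coupling_mass B)%E.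
Proof. by apply: integral_ge0 => z _; rewrite lee_fin. Qed.

(** In each coordinate separately the coupling has a density with respect to the
    law of that coordinate, hence is countably additive there. *)
Lemma coupling_mass_coord l B : measurable (B l) ->
  coupling_mass B = (\int[rho l]_(x in B l)
    (\prod_(j < k | j != l) cond_density (B j) (F l x))%:E)%E.
Proof.
move=> mB; rewrite -(integral_mul_cond_density mB
  (G := fun z => (\prod_(j < k | j != l) cond_density (B j) z)%:E)).
- by apply: eq_integral => z _; rewrite (bigD1 l)//= EFinM muleC.
- exact/measurable_EFinP.
- by move=> z; rewrite lee_fin.
Qed.

Let other_density l (B : forall i, set (T i)) (x : T l) : \bar R :=
  (\prod_(j < k | j != l) cond_density (B j) (F l x))%:E.

Let measurable_other_density l B : measurable_fun setT (@other_density l B).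
Proof.
apply/measurable_EFinP.
exact: (measurableT_comp (measurable_prod_density B (fun j => j != l)) (mF l)).
Qed.

Let other_density_ge0 l B x : (0 <= @other_density l B x)%E.
Proof. by rewrite lee_fin. Qed.

Let coupling_mass_dfwith l B (B' : set (T l)) : measurable B' ->
  coupling_mass (dfwith B l B') =
  weighted (rho l) (measurable_other_density B) (other_density_ge0 B) B'.
Proof.
move=> mB'; rewrite (@coupling_mass_coord l) dfwithin//.
apply: eq_integral => x _; congr EFin; apply: eq_bigr => j jl.
by rewrite dfwithout// eq_sym.
Qed.

Lemma coupling_mass_split l B (E : countType) (c : E -> set (T l)) :
  (forall a, measurable (c a)) -> trivIset setT c ->
  (coupling_mass (dfwith B l (\bigcup_a c a)) =
   \esum_(a in [set: E]) coupling_mass (dfwith B l (c a)))%E.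
Proof.
move=> mc tc; rewrite coupling_mass_dfwith; last first.
  exact: countable_union_measurable.
rewrite measure_countable_bigcup//; apply: eq_esum => a _.
by rewrite coupling_mass_dfwith.
Qed.

(** The density of [B i] vanishes almost everywhere outside [D]. *)
Lemma coupling_mass_on i D B : measurable (B i) -> measurable D ->
  B i `<=` F i @^-1` D ->
  coupling_mass B =
  (\int[nu]_(z in D) (\prod_(i < k) cond_density (B i) z)%:E)%E.
Proof.
move=> mB mD BD; rewrite /coupling_mass -(setUv D) ge0_integral_setU//.
- rewrite [X in (_ + X)%E](_ : _ = 0)%E ?adde0//.
  apply/eqP; rewrite eq_le integral_ge0 ?andbT; last first.
    by move=> z _; rewrite lee_fin.
  have <- : rho i (B i `&` F i @^-1` (~` D)) = 0%E.
    rewrite (_ : _ `&` _ = set0) ?measure0//.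
    by apply/seteqP; split => x //= [/BD].
  rewrite -integral_cond_density//; last exact: measurableC.
  apply: ge0_le_integral => //; first exact: measurableC.
  + by move=> z _; rewrite lee_fin.
  + by apply/measurable_funTS/measurable_EFinP.
  + by apply/measurable_funTS/measurable_EFinP/measurable_cond_density.
  + by move=> z _; rewrite lee_fin.
- exact: measurableC.
- by rewrite setUv; apply/measurable_EFinP.
- by move=> z _; rewrite lee_fin.
- by apply/disj_set2P; rewrite setICr.
Qed.

(** All densities but the [j]-th are bounded by [1].  When [B j] avoids the
    preimage of [D], the sides [B i] and [B j] have incompatible images and the
    rectangle has mass [0]. *)
Lemma coupling_mass_le i j D B : measurable (B i) -> measurable (B j) ->
  measurable D -> B i `<=` F i @^-1` D ->
  (coupling_mass B <= rho j (B j `&` F j @^-1` D))%E.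
Proof.
move=> mBi mBj mD BD; rewrite (coupling_mass_on mBi mD BD).
rewrite -integral_cond_density//; apply: ge0_le_integral => //.
+ by move=> z _; rewrite lee_fin.
+ by apply/measurable_funTS/measurable_EFinP.
+ by apply/measurable_funTS/measurable_EFinP/measurable_cond_density.
+ by move=> z _; rewrite lee_fin.
Qed.

Lemma coupling_mass_marginal i (B : set (T i)) : measurable B ->
  coupling_mass (dfwith (fun j => setT) i B) = rho i B.
Proof.
move=> mB; transitivity (\int[nu]_z (cond_density B z)%:E)%E; last first.
  by rewrite integral_cond_density// preimage_setT setIT.
have md := measurable_cond_density.
apply: ae_eq_integral => //; [exact/measurable_EFinP|exact/measurable_EFinP|].
have : {ae nu, forall z, forall j, cond_density [set: T j] z = 1}.
  by apply: filter_forall => j; exact: cond_density_setT_ae.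
apply: filterS => z h _ /=; congr EFin.
rewrite (bigD1 i)//= dfwithin big1 ?mulr1// => j ji.
by rewrite dfwithout// eq_sym.
Qed.

Lemma coupling_mass_setT : coupling_mass (fun j => setT) = 1%E.
Proof.
rewrite /coupling_mass (_ : 1%E = \int[nu]_z (cst 1 z))%E; last first.
  by rewrite integral_cst// mul1e; exact/esym/probability_setT.
apply: ae_eq_integral => //; first exact/measurable_EFinP.
have : {ae nu, forall z, forall j, cond_density [set: T j] z = 1}.
  by apply: filter_forall => j; exact: cond_density_setT_ae.
by apply: filterS => z h _ /=; congr EFin; rewrite big1.
Qed.

(** The indicator of [D] becomes a factor [k] times; it is idempotent, and [0 < k]
    makes it occur at all. *)
Lemma coupling_mass_cond B D : (0 < k)%N -> (forall i, measurable (B i)) ->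
  measurable D ->
  coupling_mass (fun i => B i `&` F i @^-1` D) =
  (\int[nu]_(z in D) (\prod_(i < k) cond_density (B i) z)%:E)%E.
Proof.
move=> k0 mB mD; rewrite [RHS]integral_mkcond epatch_indic.
apply: ae_eq_integral => //.
- exact/measurable_EFinP.
- apply: emeasurable_funM; first exact/measurable_EFinP.
  by apply/measurable_EFinP; exact: measurable_indic.
have : {ae nu, forall z, forall i, cond_density (B i `&` F i @^-1` D) z =
    cond_density (B i) z * \1_D z}.
  by apply: filter_forall => i; exact: cond_density_setI_ae.
apply: filterS => z h _ /=; rewrite -EFinM; congr EFin.
under eq_bigr do rewrite h.
rewrite big_split/= prodr_const card_ord indicE.
by case: (z \in D); rewrite ?expr1n // expr0n eqn0Ngt k0.
Qed.

(** A coupling is determined by its values on rectangles whose sides belong to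
    classes [G i] as soon as a finite measure on each factor is determined by
    its values on [G i]: the sides are freed one at a time. *)
Lemma coupling_mass_unique dQ (Omega : measurableType dQ)
    (Q : probability Omega R) (X : forall i, Omega -> T i)
    (G H : forall i, set (set (T i))) :
  (forall i, measurable_fun setT (X i)) ->
  (forall i, G i `<=` H i) -> (forall i, H i `<=` measurable) ->
  (forall i (m1 m2 : {measure set T i -> \bar R}),
    (forall B, G i B -> m1 B = m2 B) -> (m1 setT < +oo)%E ->
    forall B, H i B -> m1 B = m2 B) ->
  (forall B, (forall i, G i (B i)) ->
    Q (\bigcap_(i in [set: 'I_k]) X i @^-1` B i) = coupling_mass B) ->
  forall B, (forall i, H i (B i)) ->
    Q (\bigcap_(i in [set: 'I_k]) X i @^-1` B i) = coupling_mass B.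
Proof.
move=> mX GH mH det QG.
suff main l : forall B, (forall i, H i (B i)) ->
    (forall i : 'I_k, (l <= i)%N -> G i (B i)) ->
    Q (\bigcap_(i in [set: 'I_k]) X i @^-1` B i) = coupling_mass B.
  by move=> B HB; apply: (main k) => // i; rewrite leqNgt ltn_ord.
elim: l => [B HB GB|l IH B HB GB]; first by apply: QG => i; exact: GB.
have [kl|lk] := leqP k l.
  by apply: IH => // i li; have := ltn_ord i; rewrite ltnNge (leq_trans kl).
pose lo : 'I_k := Ordinal lk.
pose C := \bigcap_(i in [set i | i != lo]) X i @^-1` B i.
have mC : measurable C.
  apply: fin_bigcap_measurable => [|i _]; first exact: finite_finset.
  apply: (measurable_preimage (mX i)); exact: mH.
have QE B' : Q (\bigcap_(i in [set: 'I_k]) X i @^-1` (dfwith B lo B' i)) =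
    image_restr Q (mX lo) mC B'.
  rewrite /image_restr; congr (Q _); apply/seteqP; split => w.
    move=> h; split => [i /= ilo|]; have := h _ I.
      by move=> /(_ i); rewrite dfwithout// eq_sym.
    by move=> /(_ lo); rewrite dfwithin.
  move=> [h1 h2] i _; case: dfwithP => // j loj; apply: h1.
  by rewrite /= eq_sym.
have BE : B = dfwith B lo (B lo).
  by apply: functional_extensionality_dep => i; case: dfwithP.
have := HB lo; rewrite BE QE => HBlo; rewrite dfwithin in HBlo *.
rewrite coupling_mass_dfwith; last exact: mH.
apply: (det lo) HBlo => [B' GB'|]; last by rewrite ltey_eq fin_num_measure.
rewrite -[RHS]coupling_mass_dfwith; last exact/mH/GH.
rewrite -[LHS]QE; apply: IH => i; case: dfwithP => //; first exact: GH.
move=> j loj li; apply: GB; rewrite ltn_neqAle li andbT.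
by apply: contra loj => /eqP lj; apply/eqP/val_inj.
Qed.

End coupling_functional.

(** * Path spaces *)

(** Measurable types are pointed; the base path [x0] is a parameter, since a
    state space need not come with a distinguished state. *)
Definition path_space (A : Type) (x0 : nat -> A) : Type := nat -> A.

Fact path_display : measure_display. Proof. by constructor. Qed.

Section path_space_instances.
Context (A : Type) (x0 : nat -> A).

HB.instance Definition _ := gen_eqMixin (path_space x0).
HB.instance Definition _ := gen_choiceMixin (path_space x0).
HB.instance Definition _ := isPointed.Build (path_space x0) x0.

Let path_sigmaC (B : set (path_space x0)) :
  path_sigma B -> path_sigma (~` B).
Proof. by move=> sB; rewrite -setTD; exact: sigma_algebraCD. Qed.

HB.instance Definition _ := @isMeasurable.Build path_display (path_space x0)
  (@path_sigma A) (@sigma_algebra0 _ setT _) path_sigmaC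
  (@sigma_algebra_bigcup _ setT _).

End path_space_instances.

Section measurable_paths.
Context (A : countType) (x0 : nat -> A).
Local Notation path := (path_space x0).

Lemma measurable_coord t (D : set A) :
  measurable ([set x | D (x t)] : set path).
Proof. by apply: sub_gen_smallest; exists t, D. Qed.

Lemma measurable_cyl w : measurable (cyl w : set path).
Proof.
elim: w => [|a w IH]; first by rewrite cyl_nil; exact: measurableT.
rewrite cyl_cons; apply: measurableI => //.
exact: (measurable_coord (size w) [set a]).
Qed.

Lemma measurable_into_paths d (T : measurableType d) (F : T -> path) :
  (forall t (D : set A), measurable [set w | D (F w t)]) ->
  measurable_fun setT F.
Proof.
move=> mF; apply: measurability; first by [].
by move=> _ [_ [t [D ->]] <-]; rewrite setTI; exact: mF.
Qed.

Definition cylinders : set (set path) :=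
  [set B | B = set0 \/ exists w, B = cyl w].

Lemma setI_closed_cylinders : setI_closed cylinders.
Proof.
(* Two cylinders are nested or disjoint. *)
have cylI (w u : seq A) : cylinders (cyl w `&` cyl (u ++ w)).
  by right; exists (u ++ w); rewrite setIidr// cyl_cat.
have cyl_or (w u : seq A) : (size w <= size u)%N ->
    cylinders (cyl w `&` cyl u).
  move=> wu; rewrite -(cat_take_drop (size u - size w) u).
  set w' := drop _ _; set u' := take _ _.
  have sw : size w' = size w by rewrite size_drop subKn.
  have [->|ww'] := pselect (w = w'); first exact: cylI.
  left; rewrite cyl_cat setIA cyl_disjoint ?set0I//.
move=> _ _ [->|[w ->]] [->|[u ->]]; rewrite ?setI0 ?set0I; try by left.
have [|/ltnW] := leqP (size w) (size u); first exact: cyl_or.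
by rewrite setIC; exact: cyl_or.
Qed.

Lemma cylindersT : cylinders setT.
Proof. by right; exists [::]; rewrite cyl_nil. Qed.

Lemma measurable_cylinders : @measurable _ path = <<s cylinders >>.
Proof.
apply/seteqP; split; last first.
  apply: smallest_sub; first exact: sigma_algebra_measurable.
  by move=> _ [->|[w ->]]; [exact: measurable0|exact: measurable_cyl].
apply: smallest_sub; first exact: smallest_sigma_algebra.
move=> _ [t [D ->]].
(* An event that depends on the state at time [t] is a countable union of
   cylinders of length [t.+1]. *)
rewrite (_ : [set x | _] =
    \bigcup_(w in [set w : seq A | size w = t.+1 /\
      (if w is a :: _ then D a else False)]) cyl w); last first.
  apply/seteqP; split => [x Dx|x [[|a w] [//= [sw] Da]]].
    exists (past x t.+1); last exact: cyl_past.
    by rewrite /= size_past.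
  by rewrite cyl_cons => -[_ /= xa]; rewrite -sw xa.
rewrite bigcup_mkcond.
pose H w := if w \in [set w : seq A | size w = t.+1 /\
      (if w is a :: _ then D a else False)] then cyl w else set0.
have -> : \bigcup_w H w = \bigcup_n oapp H set0 (pickle_inv n).
  apply/seteqP; split => [x [w _ Hw]|x [n _]].
    by exists (pickle w) => //; rewrite pickleK_inv.
  by case: pickle_inv => //= w Hw; exists w.
apply: sigma_algebra_bigcup => n.
case: pickle_inv => [w|] /=; last exact: sigma_algebra0.
rewrite /H; case: ifP => _; last exact: sigma_algebra0.
by apply: sub_gen_smallest; right; exists w.
Qed.

Lemma measurable_path_shift n :
  measurable_fun setT (path_shift n : path -> path).
Proof.
apply: measurable_into_paths => t D; exact: (measurable_coord (t + n) D).
Qed.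

Lemma measurable_path_cons a : measurable_fun setT (path_cons a : path -> path).
Proof.
apply: measurable_into_paths => -[|t] D /=; last exact: measurable_coord.
have [Da|nDa] := pselect (D a).
  by rewrite (_ : [set _ | _] = setT)//; apply/seteqP; split.
by rewrite (_ : [set _ | _] = set0)//; apply/seteqP; split.
Qed.

Lemma measurable_graft w : measurable_fun setT (graft w : path -> path).
Proof.
elim: w => [|a w IH] /=; first exact: measurable_id.
exact: (measurableT_comp IH (measurable_path_cons a)).
Qed.

Lemma measurable_trajectory d (Omega : measurableType d)
    (X : nat -> Omega -> A) :
  process X -> measurable_fun setT (trajectory X : Omega -> path).
Proof. by move=> pX; apply: measurable_into_paths => t D; exact: pX. Qed.

End measurable_paths.

Lemma measurable_path_fmap (A B : countType) (x0 : nat -> A) (y0 : nat -> B)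
    (f : A -> B) :
  measurable_fun setT (path_fmap f : path_space x0 -> path_space y0).
Proof.
apply: measurable_into_paths => t D.
exact: (measurable_coord x0 t (f @^-1` D)).
Qed.

(** * Path laws and the Markov property *)

Section path_law.
Context (R : realType) d (Omega : measurableType d) (P : probability Omega R).
Context (A : countType) (X : nat -> Omega -> A) (x0 : nat -> A).
Hypothesis pX : process X.

Definition path_law & process X : set (path_space x0) -> \bar R :=
  fun B => P (trajectory X @^-1` B).

Local Notation law := (path_law pX).

Let mX := measurable_trajectory (x0 := x0) pX.

Let law0 : law set0 = 0%E.
Proof. by rewrite /path_law preimage_set0 measure0. Qed.

Let law_ge0 B : (0 <= law B)%E.
Proof. exact: measure_ge0. Qed.

Let law_sigma_additive : semi_sigma_additive law.
Proof.
move=> G mG tG mUG; rewrite /path_law preimage_bigcup.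
apply: measure_semi_sigma_additive.
- by move=> n; exact: (measurable_preimage mX (mG n)).
- apply/trivIsetP => i j _ _ ij; rewrite -preimage_setI.
  by move/trivIsetP : tG => /(_ _ _ I I ij) ->; rewrite preimage_set0.
- by apply: bigcup_measurable => n _; exact: (measurable_preimage mX (mG n)).
Qed.

HB.instance Definition _ := isMeasure.Build _ _ _ law
  law0 law_ge0 law_sigma_additive.

Let lawT : law setT = 1%E.
Proof. by rewrite /path_law preimage_setT probability_setT. Qed.

HB.instance Definition _ := Measure_isProbability.Build _ _ _ law lawT.

End path_law.
Arguments path_law {R d Omega} P {A X} x0 pX.

Lemma path_measure_unique (R : realType) (A : countType) (x0 : nat -> A)
    (m1 m2 : {measure set (path_space x0) -> \bar R}) :
  (forall w, m1 (cyl w) = m2 (cyl w)) -> (m1 setT < +oo)%E ->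
  forall B, measurable B -> m1 B = m2 B.
Proof.
move=> m12 m1T.
apply: (measure_unique (cylinders (x0 := x0)) (fun=> setT)) => //.
- exact: measurable_cylinders.
- exact: setI_closed_cylinders.
- by move=> _; exact: cylindersT.
- by apply/seteqP; split => // x _; exists 0%N.
- by move=> _ [->|[w ->]]; rewrite ?measure0.
Qed.

(** A cylinder is the countable disjoint union of those that extend its word by
    one state, so its measure is a sum over cylinders of length [N]. *)
Lemma cyl_length_determining (R : realType) (A : countType) (x0 : nat -> A)
    (N : nat) (m1 m2 : {measure set (path_space x0) -> \bar R}) :
  (forall w : seq A, size w = N -> m1 (cyl w) = m2 (cyl w)) ->
  forall w : seq A, (size w <= N)%N -> m1 (cyl w) = m2 (cyl w).
Proof.
move=> m12 w wN; move: (subnK wN); move: (N - size w)%N => n.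
elim: n w {wN} => [|n IH] w sw; first exact: m12.
rewrite cyl_children.
have mc a := measurable_cyl x0 (a :: w).
have tc := @trivIset_children A w.
rewrite (measure_countable_bigcup m1 mc tc) (measure_countable_bigcup m2 mc tc).
by apply: eq_esum => a _; apply: IH; rewrite -sw addSnnS.
Qed.

Section markov_law.
Context (R : realType) (A : countType) (x0 : nat -> A).
Variables (rho : probability (path_space x0) R).

(** The homogeneous Markov property without transition probabilities: the
    conditional law of the future given the past depends on the present state
    only.  The cross product form covers pasts of probability [0]. *)
Definition markov_law :=
  forall a w w' (B : set (path_space x0)), measurable B ->
  (rho (cyl (a :: w) `&` path_shift (size w).+1 @^-1` B) *
     rho (cyl (a :: w')) =
   rho (cyl (a :: w') `&` path_shift (size w').+1 @^-1` B) *
     rho (cyl (a :: w)))%E.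

(** As functions of [B] both sides are finite measures.  On the cylinder of a
    word [u] both are the product of the probabilities of the two pasts and of
    the transition probabilities along [u], started from [a]. *)
Lemma markov_law_of_transitions (p : A -> A -> R) :
  (forall a b w, rho (cyl (b :: a :: w)) = rho (cyl (a :: w)) * (p a b)%:E)%E ->
  markov_law.
Proof.
move=> rhoS a w w' B mB.
pose fix weight u := if u is b :: u' then weight u' * p (head a u') b else 1.
have rho_cat v u :
    rho (cyl (u ++ a :: v)) = (rho (cyl (a :: v)) * (weight u)%:E)%E.
  elim: u => [|b u IH] /=; first by rewrite mule1.
  have [b' [u' E]] : exists b' u', u ++ a :: v = b' :: u' /\ b' = head a u.
    by case: (u) => [|b' u']; [exists a, v|exists b', (u' ++ a :: v)].
  case: E => E <-; rewrite E rhoS -E IH EFinM; exact/esym/muleA.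
have c_ge0 v : 0 <= fine (rho (cyl (a :: v))) by exact: fine_ge0.
have mC v := measurable_cyl x0 (a :: v).
have ms (v : seq A) := measurable_path_shift (x0 := x0) (size v).+1.
pose m v v' : {measure set (path_space x0) -> \bar R} :=
  mscale (NngNum (c_ge0 v')) (image_restr rho (ms v) (mC v)).
have mE v v' D : m v v' D =
    (rho (cyl (a :: v) `&` path_shift (size v).+1 @^-1` D) *
     rho (cyl (a :: v')))%E.
  by rewrite /m /= /mscale /= /image_restr muleC fineK// fin_num_measure.
rewrite -!mE; apply: path_measure_unique => // [u|]; rewrite !mE.
  have cE v := cyl_cat u (a :: v); rewrite /= in cE.
  rewrite -!cE !rho_cat muleAC [RHS]muleAC.
  by congr (_ * _)%E; rewrite muleC.
by rewrite ltey_eq fin_numM ?fin_num_measure// preimage_setT setIT.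
Qed.

End markov_law.

Lemma markov_law_chain (R : realType) d (Omega : measurableType d)
    (P : probability Omega R) (A : countType) (X : nat -> Omega -> A)
    (x0 : nat -> A) (pX : process X) :
  homogeneous_markov_chain P X -> markov_law (path_law P x0 pX).
Proof.
move=> [mu [p [_ _ _ _ H]]]; apply: (@markov_law_of_transitions _ _ _ _ p).
move=> a b w.
have lawE v : path_law P x0 pX (cyl v) = P (trajectory X @^-1` cyl v) by [].
rewrite [LHS]lawE [X in (X * _)%E]lawE.
have mX := measurable_trajectory (x0 := x0) pX.
have mE v : measurable (trajectory X @^-1` cyl v).
  exact: (measurable_preimage mX (measurable_cyl x0 v)).
(* Histories are given by paths: any path that starts with the word will do. *)
pose x := graft (a :: w) (fun=> a).
have xp : past x (size w).+1 = a :: w by exact: cyl_graft.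
have hist : history X (size w) x = trajectory X @^-1` cyl (a :: w).
  apply/seteqP; split => v h.
    change (past (trajectory X v) (size w).+1 = a :: w).
    by rewrite -xp; apply/past_eq.
  move: h; change (past (trajectory X v) (size w).+1 = a :: w ->
    history X (size w) x v).
  by rewrite -xp => /past_eq.
have step : trajectory X @^-1` cyl (b :: a :: w) =
    X (size w).+1 @^-1` [set b] `&` trajectory X @^-1` cyl (a :: w).
  by rewrite [in LHS]cyl_cons setIC.
have [P0|P0] := eqVneq (P (trajectory X @^-1` cyl (a :: w))) 0%E.
  rewrite P0 mul0e; apply/eqP; rewrite -measure_le0 -P0 step.
  by apply: le_measure; rewrite ?inE//; apply: measurableI => //; exact: pX.
have xw : x (size w) = a by case: xp.
have := H (size w) x b; rewrite hist => /(_ P0); rewrite /cprob -step xw => <-.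
rewrite -[in RHS](fineK (fin_num_measure P _ (mE (a :: w)))) -EFinM mulrC.
rewrite divfK; first by rewrite fineK// fin_num_measure.
by rewrite fine_eq0 // fineK //; exact: fin_num_measure.
Qed.

(** * The coupling of Markov laws *)

Lemma ratio_of_cross_product (R : realType) (x y : \bar R) (u v : R) :
  x \is a fin_num -> y \is a fin_num -> v != 0 ->
  (x * v%:E = y * u%:E)%E -> x = ((u / v)%:E * y)%E.
Proof.
move=> /fineK <- /fineK <- v0; rewrite -!EFinM => -[E]; congr EFin.
by apply: (mulIf v0); rewrite E [RHS]mulrAC divfK// mulrC.
Qed.

Section markov_coupling.
Context (R : realType) (k : nat) (A : 'I_k -> countType) (C : countType).
Context (f : forall i, A i -> C) (xA : forall i, nat -> A i) (zC : nat -> C).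
Variables (rho : forall i, probability (path_space (xA i)) R).
Variables (nu : probability (path_space zC) R).

Definition path_image i (x : path_space (xA i)) : path_space zC :=
  path_fmap (@f i) x.
Arguments path_image i x : clear implicits.

Lemma measurable_path_image i : measurable_fun setT (path_image i).
Proof. exact: measurable_path_fmap. Qed.

Arguments measurable_path_image : clear implicits.

Hypothesis rhoF :
  forall i D, measurable D -> rho i (path_image i @^-1` D) = nu D.

Local Notation mF := measurable_path_image.
Local Notation density := (cond_density mF rhoF).
Local Notation mass := (coupling_mass mF rhoF).

(** On the event that the image path starts with [z], it is [graft z y] for its
    future [y]; so densities become functions of [y], which are integrated
    against the law of the future on that event. *)
Section fixed_past.
Variables (z : seq C).
Let n := size z.

Definition future_law :=
  image_restr nu (measurable_path_shift (x0 := zC) n) (measurable_cyl zC z).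

HB.instance Definition _ := FiniteMeasure.on future_law.

Lemma integral_future_law (g : path_space zC -> \bar R) D : measurable D ->
  measurable_fun setT g -> (forall y, 0 <= g y)%E ->
  (\int[future_law]_(y in D) g (graft z y) =
   \int[nu]_(y in cyl z `&` path_shift n @^-1` D) g y)%E.
Proof.
move=> mD mg g0; rewrite /future_law integral_image_restr//; last first.
  exact: (measurableT_comp mg (measurable_graft z)).
by apply: eq_integral => y /set_mem [zy _]; rewrite graft_path_shift.
Qed.

Lemma integral_density_graft i (E : set (path_space (xA i))) D :
  measurable E -> E `<=` path_image i @^-1` cyl z -> measurable D ->
  (\int[future_law]_(y in D) (density E (graft z y))%:E =
   rho i (E `&` path_image i @^-1` (path_shift n @^-1` D)))%E.
Proof.
move=> mE Ez mD.
have md := measurable_cond_density mF rhoF E.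
rewrite (integral_future_law (g := fun y => (density E y)%:E))//.
- rewrite integral_cond_density//; last first.
    apply: measurableI; first exact: measurable_cyl.
    exact: (measurable_preimage (measurable_path_shift n)).
  by rewrite preimage_setI setIA (setIidl Ez).
- exact/measurable_EFinP.
- by move=> y; rewrite lee_fin cond_density_ge0.
Qed.

Lemma mass_graft (i0 : 'I_k) (E : forall i, set (path_space (xA i))) :
  measurable (E i0) -> E i0 `<=` path_image i0 @^-1` cyl z ->
  mass E = (\int[future_law]_y (\prod_(i < k) density (E i) (graft z y))%:E)%E.
Proof.
move=> mE Ez; rewrite (coupling_mass_on mF rhoF mE (measurable_cyl zC z) Ez).
rewrite (integral_future_law
  (g := fun y => (\prod_(i < k) density (E i) y)%:E))//.
- by rewrite preimage_setT setIT.
- apply/measurable_EFinP.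
  apply: (measurable_prod (s := index_enum _)
    (h := fun i y => density (E i) y)) => i _.
  exact: measurable_cond_density.
- by move=> y; rewrite lee_fin prodr_ge0// => i _; exact: cond_density_ge0.
Qed.

End fixed_past.

Hypothesis nu_markov : markov_law nu.
Hypothesis rho_markov : forall i, markov_law (rho i).

(** Take two pasts with the same present state [a].  By the Markov property of
    [nu] the two laws of the future of the image are proportional.  By that of
    [rho i] so are the integrals of the [i]-th densities over events of the
    future, hence the densities themselves, as functions of the future.  Thus the
    masses are proportional, with a factor that does not depend on [B]. *)
Lemma mass_future_proportional (i0 : 'I_k) (a : forall i, A i) (c : C)
    (w w' : forall i, seq (A i)) (z z' : seq C) :
  (forall i, f (a i) = c) ->
  (forall i, map (@f i) (w i) = z) -> (forall i, map (@f i) (w' i) = z') ->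
  nu (cyl (c :: z)) != 0%E -> nu (cyl (c :: z')) != 0%E ->
  (forall i, rho i (cyl (a i :: w i)) != 0%E) ->
  (forall i, rho i (cyl (a i :: w' i)) != 0%E) ->
  exists r : R, forall B : forall i, set (path_space (xA i)),
    (forall i, measurable (B i)) ->
    (mass (fun i => cyl (a i :: w i) `&` path_shift (size z).+1 @^-1` B i) =
     r%:E *
     mass (fun i => cyl (a i :: w' i) `&` path_shift (size z').+1 @^-1` B i))%E.
Proof.
move=> fa fw fw' v0 v'0 r0 r'0.
pose v := fine (nu (cyl (c :: z))); pose v' := fine (nu (cyl (c :: z'))).
pose r i := fine (rho i (cyl (a i :: w i))).
pose r' i := fine (rho i (cyl (a i :: w' i))).
have vE : nu (cyl (c :: z)) = v%:E.
  by rewrite fineK// fin_num_measure//; exact: measurable_cyl.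
have v'E : nu (cyl (c :: z')) = v'%:E.
  by rewrite fineK// fin_num_measure//; exact: measurable_cyl.
have rE i : rho i (cyl (a i :: w i)) = (r i)%:E.
  by rewrite fineK// fin_num_measure//; exact: measurable_cyl.
have r'E i : rho i (cyl (a i :: w' i)) = (r' i)%:E.
  by rewrite fineK// fin_num_measure//; exact: measurable_cyl.
have vn0 : v != 0 by move: v0; rewrite vE.
have v'n0 : v' != 0 by move: v'0; rewrite v'E.
have r'n0 i : r' i != 0 by have := r'0 i; rewrite r'E.
have s0 : 0 <= v / v'.
  by rewrite divr_ge0// -lee_fin -?vE -?v'E measure_ge0.
(* [s] is the ratio of the two laws of the future, [q i] that of the two [i]-th
   densities. *)
pose s := v / v'; have sn0 : s != 0 by rewrite mulf_neq0// invr_neq0.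
have futE D : measurable D ->
    future_law (c :: z) D = mscale (NngNum s0) (future_law (c :: z')) D.
  move=> mD; have := nu_markov c z z' mD; rewrite vE v'E.
  apply: ratio_of_cross_product v'n0.
  - exact: (fin_num_measure (future_law (c :: z))).
  - exact: (fin_num_measure (future_law (c :: z'))).
have int_fut (g : path_space zC -> \bar R) D : measurable D ->
    measurable_fun setT g -> (forall y, 0 <= g y)%E ->
    (\int[future_law (c :: z)]_(y in D) g y =
     s%:E * \int[future_law (c :: z')]_(y in D) g y)%E.
  move=> mD mg g0; rewrite -(ge0_integral_mscale _ mD (NngNum s0))//.
    by apply: eq_measure_integral => D' mD' _; exact: futE.
  exact: measurable_funTS.
pose q i := r i / (r' i * s).
have q0 i : 0 <= q i.
  rewrite divr_ge0//; first by rewrite -lee_fin -rE.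
  by rewrite mulr_ge0// -lee_fin -r'E.
exists (s * \prod_(i < k) q i) => B mB.
pose E i := cyl (a i :: w i) `&` path_shift (size z).+1 @^-1` B i.
pose E' i := cyl (a i :: w' i) `&` path_shift (size z').+1 @^-1` B i.
have mE i : measurable (E i : set (path_space (xA i))).
  apply: measurableI; first exact: measurable_cyl.
  exact: (measurable_preimage (measurable_path_shift (x0 := xA i) _) (mB i)).
have mE' i : measurable (E' i : set (path_space (xA i))).
  apply: measurableI; first exact: measurable_cyl.
  exact: (measurable_preimage (measurable_path_shift (x0 := xA i) _) (mB i)).
have Ez i : E i `<=` path_image i @^-1` cyl (c :: z).
  by move=> x [+ _] => /(@cyl_map _ _ (@f i)); rewrite /= fa fw.
have Ez' i : E' i `<=` path_image i @^-1` cyl (c :: z').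
  by move=> x [+ _] => /(@cyl_map _ _ (@f i)); rewrite /= fa fw'.
have mdg i (D : set (path_space (xA i))) u :
    measurable_fun setT (fun y : path_space zC => density D (graft u y)).
  exact: (measurableT_comp (measurable_cond_density mF rhoF D)
    (measurable_graft (x0 := zC) u)).
have int01 i (G : set (path_space (xA i))) u :
    (future_law (c :: z')).-integrable setT
      (fun y => (density G (graft u y))%:E).
  apply: (integrable_01 (future_law (c :: z'))
    (g := fun y => density G (graft u y))) => // y.
  by rewrite cond_density_ge0 cond_density_le1.
have finint i (G : set (path_space (xA i))) u D : measurable D ->
    (\int[future_law (c :: z')]_(y in D) (density G (graft u y))%:E)%E
      \is a fin_num.
  move=> mD; apply: integrable_fin_num => //.
  exact: integrableS (int01 _ G u).
have prop : {ae future_law (c :: z'), forall y, forall i,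
    density (E i) (graft (c :: z) y) = q i * density (E' i) (graft (c :: z') y)}.
  apply: filter_forall => i.
  suff : ae_eq (future_law (c :: z')) setT
      (fun y => (density (E i) (graft (c :: z) y))%:E)
      (fun y => (q i * density (E' i) (graft (c :: z') y))%:E).
    by apply: filterS => y /(_ I) [].
  apply: integral_ae_eq => //.
  - by apply/measurable_EFinP; apply: measurable_funM.
  move=> D _ mD; under [RHS]eq_integral do rewrite EFinM.
  rewrite ge0_integralZl//; last 3 first.
  - exact/measurable_funTS/measurable_EFinP.
  - by move=> y _; rewrite lee_fin cond_density_ge0.
  - by rewrite lee_fin.
  have mBD : measurable (B i `&` path_image i @^-1` D).
    apply: measurableI; first exact: mB.
    exact: (measurable_preimage (measurable_path_image i) mD).
  apply: ratio_of_cross_product.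
  - exact: finint.
  - exact: finint.
  - by rewrite mulf_neq0.
  rewrite EFinM muleCA [X in (_ * X)%E]muleC -int_fut//; last 2 first.
  - exact/measurable_EFinP.
  - by move=> y; rewrite lee_fin cond_density_ge0.
  rewrite (integral_density_graft (mE i) (Ez i) mD).
  rewrite (integral_density_graft (mE' i) (Ez' i) mD).
  have := rho_markov (a i) (w i) (w' i) mBD; rewrite rE r'E muleC.
  have sw : size (w i) = size z by rewrite -(fw i) size_map.
  have sw' : size (w' i) = size z' by rewrite -(fw' i) size_map.
  by rewrite sw sw' !preimage_setI !setIA.
change (mass E = (s * \prod_(i < k) q i)%:E * mass E')%E.
rewrite (@mass_graft (c :: z) i0 E (mE i0) (Ez i0)).
rewrite (@mass_graft (c :: z') i0 E' (mE' i0) (Ez' i0)).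
have mprod (G : forall i, set (path_space (xA i))) u : measurable_fun setT
    (fun y : path_space zC => (\prod_(i < k) density (G i) (graft u y))%:E).
  apply/measurable_EFinP; apply: (measurable_prod (s := index_enum _)
    (h := fun i (y : path_space zC) => density (G i) (graft u y))) => i _.
  exact: mdg.
have prod0 (G : forall i, set (path_space (xA i))) u y :
    (0 <= (\prod_(i < k) density (G i) (graft u y))%:E)%E.
  by rewrite lee_fin prodr_ge0// => i _; exact: cond_density_ge0.
rewrite int_fut// (EFinM s) -[RHS]muleA; congr (_ * _)%E.
transitivity (\int[future_law (c :: z')]_y ((\prod_(i < k) q i)%:E *
    (\prod_(i < k) density (E' i) (graft (c :: z') y))%:E))%E; last first.
  by rewrite ge0_integralZl// lee_fin prodr_ge0.
apply: ae_eq_integral => //; first exact: emeasurable_funM.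
move: prop; apply: filterS.
  exact: (ae_filter_ringOfSetsType (future_law (c :: z'))).
move=> y h _ /=; rewrite -EFinM -big_split/=; congr EFin.
by apply: eq_bigr => i _; rewrite h.
Qed.

(** * The coupled chain *)

Variable i0 : 'I_k.

Local Notation E := {dffun forall i : 'I_k, A i}.

(** The probability that the coupled process starts with [w]. *)
Definition word_mass (w : seq E) : R := fine (mass (fun i => cyl (column w i))).

Let mcyl i (u : seq (A i)) : measurable (cyl u : set (path_space (xA i))).
Proof. exact: measurable_cyl. Qed.

Let mass_le B i : measurable (B i0) -> measurable (B i) ->
  (mass B <= rho i (B i))%E.
Proof.
move=> mB0 mB; rewrite -[X in rho i X]setIT.
exact: (@coupling_mass_le _ _ _ _ _ _ _ _ _ mF rhoF i0 i setT).
Qed.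

Let mass_fin B : measurable (B i0) -> mass B \is a fin_num.
Proof.
move=> mB; rewrite ge0_fin_numE ?coupling_mass_ge0//.
by apply: (le_lt_trans (mass_le mB mB)); rewrite ltey_eq fin_num_measure.
Qed.

Lemma word_massE w : (word_mass w)%:E = mass (fun i => cyl (column w i)).
Proof. by rewrite fineK//; apply: mass_fin; exact: mcyl. Qed.

Lemma word_mass_ge0 w : 0 <= word_mass w.
Proof. by rewrite -lee_fin word_massE coupling_mass_ge0. Qed.

Lemma word_mass_nil : word_mass [::] = 1.
Proof.
apply: EFin_inj; rewrite word_massE -(coupling_mass_setT mF rhoF).
apply: (congr1 mass); apply: functional_extensionality_dep => i.
exact: cyl_nil.
Qed.

Lemma word_mass_sum w :
  (\esum_(e in [set: E]) (word_mass (e :: w))%:E = (word_mass w)%:E)%E.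
Proof.
rewrite word_massE; under eq_esum do rewrite word_massE.
rewrite (@esum_dffun R k A _ mass _ (fun i a => cyl (a :: column w i))
  [ffun i => xA i 0%N])//; first by move=> B; exact: coupling_mass_ge0.
move=> l B; rewrite cyl_children.
by apply: coupling_mass_split => [a|]; [exact: mcyl|exact: trivIset_children].
Qed.

Lemma word_mass_rho_neq0 w i : word_mass w != 0 ->
  rho i (cyl (column w i)) != 0%E.
Proof.
apply: contraNneq => r0; apply/eqP; apply: EFin_inj; rewrite word_massE.
apply/eqP; rewrite eq_le coupling_mass_ge0 andbT.
by rewrite (le_trans (@mass_le (fun i => cyl (column w i)) i _ _)) ?r0//;
  exact: mcyl.
Qed.

Lemma rho_cyl_le i (u : seq (A i)) :
  (rho i (cyl u) <= nu (cyl (map (@f i) u)))%E.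
Proof.
have mz := measurable_cyl zC (map (@f i) u).
rewrite -(rhoF i mz).
apply: le_measure; rewrite ?inE; [exact: mcyl| |exact: cyl_map].
exact: (measurable_preimage (mF i) mz).
Qed.

(** Components with different image words lie in preimages of disjoint
    cylinders. *)
Lemma word_mass_compatible w i j : word_mass w != 0 ->
  map (@f i) (column w i) = map (@f j) (column w j).
Proof.
move=> w0; apply: contrapT => ij; move/eqP: w0; apply; apply: EFin_inj.
rewrite word_massE; apply/eqP; rewrite eq_le coupling_mass_ge0 andbT.
have mz := measurable_cyl zC (map (@f i) (column w i)).
apply: le_trans (_ : (rho j set0 <= _)%E); last by rewrite measure0.
have -> : set0 = cyl (column w j) `&`
    path_image j @^-1` cyl (map (@f i) (column w i)).
  apply/esym/seteqP; split => // x [/(@cyl_map _ _ (@f j)) jx ix].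
  have := @cyl_disjoint _ (map (@f i) (column w i)) (map (@f j) (column w j)).
  rewrite !size_map => /(_ erefl ij) disj.
  suff : set0 (path_image j x) by [].
  by rewrite -disj.
apply: (@coupling_mass_le _ _ _ _ _ _ _ _ _ mF rhoF i j _
  (fun i => cyl (column w i)) (mcyl _) (mcyl _) mz).
exact: cyl_map.
Qed.

(** The probability of stepping from [a] to [b] is the same after both pasts: the
    masses with no condition on the future and with next state [b] are
    proportional with the same factor. *)
Lemma word_mass_ratio a b w w' :
  word_mass (a :: w) != 0 -> word_mass (a :: w') != 0 ->
  word_mass (b :: a :: w) * word_mass (a :: w') =
  word_mass (b :: a :: w') * word_mass (a :: w).
Proof.
move=> n0 n0'.
pose z v := map (@f i0) (column v i0).
have comp v i : word_mass (a :: v) != 0 ->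
    f (a i) = f (a i0) /\ map (@f i) (column v i) = z v.
  by move=> /(@word_mass_compatible _ i i0) [].
have nu0 v : word_mass (a :: v) != 0 -> nu (cyl (f (a i0) :: z v)) != 0%E.
  move=> /(@word_mass_rho_neq0 _ i0); apply: contraNneq => v0.
  by rewrite -measure_le0 -v0 (le_trans (rho_cyl_le _)).
have [r rE] := @mass_future_proportional i0 a (f (a i0))
  (column w) (column w') (z w) (z w')
  (fun i => (comp w i n0).1) (fun i => (comp w i n0).2)
  (fun i => (comp w' i n0').2) (nu0 _ n0) (nu0 _ n0')
  (fun i => word_mass_rho_neq0 i n0) (fun i => word_mass_rho_neq0 i n0').
have wE v : size (z v) = size v by rewrite size_map size_column.
have present v : word_mass (a :: v) = fine (mass (fun i =>
    cyl (a i :: column v i) `&` path_shift (size (z v)).+1 @^-1` setT)).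
  rewrite /word_mass; congr fine; apply: (congr1 mass).
  by apply: functional_extensionality_dep => i; rewrite setIT.
have next v : word_mass (b :: a :: v) = fine (mass (fun i =>
    cyl (a i :: column v i) `&` path_shift (size (z v)).+1 @^-1` cyl [:: b i])).
  rewrite /word_mass; congr fine; apply: (congr1 mass).
  apply: functional_extensionality_dep => i.
  by rewrite wE -(size_column v i) -(cyl_cat [:: b i] (a i :: column v i)).
have mshift i v (D : set (path_space (xA i))) : measurable D ->
    measurable (cyl (a i :: column v i) `&` path_shift (size (z v)).+1 @^-1` D :
      set (path_space (xA i))).
  move=> mD; apply: measurableI; first exact: mcyl.
  exact: (measurable_preimage (measurable_path_shift (x0 := xA i) _) mD).
have mT i : measurable (setT : set (path_space (xA i))) by [].
have mN i : measurable (cyl [:: b i] : set (path_space (xA i))) by exact: mcyl.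
rewrite (next w) (present w) !rE// !fineM ?mass_fin//; try exact: mshift.
by rewrite -(next w') -(present w') -mulrA [RHS]mulrCA.
Qed.

(** * Realization by a process *)

Section realization.
Context (d : measure_display) (Omega : measurableType d).
Variables (Q : probability Omega R) (Y : nat -> Omega -> E).
Hypothesis pY : process Y.
Hypothesis QY : forall w, Q [set u | cyl w (Y^~ u)] = (word_mass w)%:E.
Hypothesis Y_charged : forall u n, 0 < word_mass (past (Y^~ u) n).

Definition component (i : 'I_k) (t : nat) (u : Omega) : A i := Y t u i.

Definition common_image (t : nat) (u : Omega) : C := f (component i0 t u).

Lemma jointE : joint component = Y.
Proof.
apply/funext => t; apply/funext => u; apply/ffunP => i.
by rewrite /joint ffunE.
Qed.

Let past_component u n i :
  past (trajectory (component i) u) n = column (past (Y^~ u) n) i.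
Proof. by elim: n => //= n ->. Qed.

Lemma component_image i t u : common_image t u = f (component i t u).
Proof.
have := word_mass_compatible i0 i (lt0r_neq0 (Y_charged u t.+1)).
by case.
Qed.

Lemma measurable_component i :
  measurable_fun setT (trajectory (component i) : Omega -> path_space (xA i)).
Proof.
apply: measurable_trajectory => t D.
exact: (pY t [set e : E | D (e i)]).
Qed.

Lemma coupled_chain_markov : homogeneous_markov_chain Q (joint component).
Proof.
rewrite jointE.
(* The transition probabilities from [e] are read off some word of positive mass
   that ends in [e]; any distribution serves from the other states. *)
pose visited (e : E) := exists w, word_mass (e :: w) != 0.
pose p (e e' : E) : R := if pselect (visited e) is left h
  then word_mass (e' :: e :: projT1 (cid h)) / word_mass (e :: projT1 (cid h))
  else (e' == e)%:R.
exists (fun e => word_mass [:: e]), p; split => //.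
- split => [e|]; first exact: word_mass_ge0.
  by rewrite word_mass_sum word_mass_nil.
- move=> e; rewrite /p; case: pselect => [h|_]; last first.
    exact: distribution_on_dirac.
  case: cid => w /= w0; split => [e'|].
    by rewrite divr_ge0// word_mass_ge0.
  under eq_esum do rewrite mulrC EFinM.
  rewrite esumZl; last 2 first.
  - by move=> e'; rewrite lee_fin word_mass_ge0.
  - by rewrite invr_ge0 word_mass_ge0.
  by rewrite word_mass_sum -EFinM mulVf.
- move=> e; rewrite -[RHS]/(fine (word_mass [:: e])%:E) -QY; congr (fine (Q _)).
  by apply/seteqP; split => u; rewrite /cyl /=; [move=> ->|case].
move=> n x y.
have histE v : history Y n v = [set u | cyl (past v n.+1) (Y^~ u)].
  apply/seteqP; split => u h.
    change (past (Y^~ u) (size (past v n.+1)) = past v n.+1).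
    by rewrite size_past; apply/past_eq.
  move: h; change (past (Y^~ u) (size (past v n.+1)) = past v n.+1 ->
    history Y n v u).
  by rewrite size_past => /past_eq.
rewrite histE QY eqe => x0; rewrite /cprob.
have -> : Y n.+1 @^-1` [set y] `&` [set u | cyl (past x n.+1) (Y^~ u)] =
    [set u | cyl (y :: past x n.+1) (Y^~ u)].
  apply/seteqP; split => u; rewrite /= (cyl_cons y) /= size_past => -[? ?].
    by split.
  by split.
rewrite !QY /p; case: pselect => [h|]; last by case; exists (past x n).
case: cid => w /= w0.
apply/eqP; rewrite eqr_div//; apply/eqP.
exact: word_mass_ratio.
Qed.

(** The rectangles of cylinders of one common length are the events that [Y]
    starts with a given word; from these one passes to cylinders of arbitrary
    lengths, and then to arbitrary path events. *)
Lemma component_law (B : forall i, set (path_space (xA i))) :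
  (forall i, measurable (B i)) ->
  Q (\bigcap_(i in [set: 'I_k]) trajectory (component i) @^-1` B i) = mass B.
Proof.
pose Geq (N : nat) i : set (set (path_space (xA i))) :=
  [set D | exists u : seq (A i), size u = N /\ D = cyl u].
pose Gle (N : nat) i : set (set (path_space (xA i))) :=
  [set D | exists u : seq (A i), (size u <= N)%N /\ D = cyl u].
pose Gall i : set (set (path_space (xA i))) :=
  [set D | exists u : seq (A i), D = cyl u].
have mX := measurable_component.
have law_eq N D : (forall i, Geq N i (D i)) ->
    Q (\bigcap_(i in [set: 'I_k]) trajectory (component i) @^-1` D i) = mass D.
  move=> GD; pose u i := projT1 (cid (GD i)).
  have uP i : size (u i) = N /\ D i = cyl (u i) by exact: (projT2 (cid (GD i))).
  have [w [sw wu]] := word_of_columns (fun i => (uP i).1) (fun i => xA i 0%N).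
  have -> : D = fun i => cyl (column w i).
    by apply: functional_extensionality_dep => i; rewrite wu; case: (uP i).
  rewrite -word_massE -QY; congr (Q _); apply/seteqP; split => v h.
    change (past (Y^~ v) (size w) = w); apply: column_inj => [|i].
      by rewrite size_past.
    rewrite -past_component; have := h i I; rewrite /= /cyl /= size_column.
    exact.
  move=> i _; rewrite /= /cyl /= size_column past_component.
  move: h; change (past (Y^~ v) (size w) = w ->
    column (past (Y^~ v) (size w)) i = column w i).
  by move=> ->.
have law_le N D : (forall i, Gle N i (D i)) ->
    Q (\bigcap_(i in [set: 'I_k]) trajectory (component i) @^-1` D i) = mass D.
  apply: (coupling_mass_unique (G := Geq N) (H := Gle N)) => //.
  - by move=> i _ [u [uN ->]]; exists u; rewrite uN.
  - by move=> i _ [u [uN ->]]; exact: mcyl.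
  - move=> i m1 m2 m12 _ _ [u [uN ->]].
    apply: (cyl_length_determining (N := N)) uN => v vN.
    by apply: m12; exists v.
  - exact: law_eq.
apply: (coupling_mass_unique (G := Gall) (H := fun i => measurable)) => //.
- by move=> i _ [u ->]; exact: mcyl.
- by move=> i D.
- move=> i m1 m2 m12 m1T; apply: path_measure_unique m1T => u.
  by apply: m12; exists u.
move=> D GD; pose u i := projT1 (cid (GD i)).
have uP i : D i = cyl (u i) by exact: (projT2 (cid (GD i))).
apply: (law_le (\max_(i < k) size (u i))%N) => i; exists (u i).
by split; [exact: (leq_bigmax i)|exact: uP].
Qed.

Lemma component_marginal i (B : set (path_space (xA i))) : measurable B ->
  Q (trajectory (component i) @^-1` B) = rho i B.
Proof.
move=> mB; rewrite -(coupling_mass_marginal mF rhoF mB) -component_law.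
  congr (Q _); apply/seteqP; split => u; last first.
    by move=> /(_ i I); rewrite /= dfwithin.
  by move=> h j _; case: dfwithP.
by move=> j; case: dfwithP.
Qed.

Let trajectory_image i u :
  trajectory common_image u = path_image i (trajectory (component i) u).
Proof. by apply/funext => t; rewrite /trajectory (component_image i). Qed.

Lemma common_image_law (D : set (path_space zC)) : measurable D ->
  Q (trajectory common_image @^-1` D) = nu D.
Proof.
move=> mD; rewrite -(rhoF i0 mD) -component_marginal//.
exact: (measurable_preimage (mF i0) mD).
Qed.

Let measurable_common_image :
  measurable_fun setT (trajectory common_image : Omega -> path_space zC).
Proof.
apply: measurable_trajectory => t D.
exact: (pY t [set e : E | D (f (e i0))]).
Qed.

Let integral_common_image (g : path_space zC -> \bar R)
    (D : set (path_space zC)) : measurable D ->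
  measurable_fun setT g -> (forall y, 0 <= g y)%E ->
  (\int[Q]_(u in trajectory common_image @^-1` D)
     g (trajectory common_image u) =
   \int[nu]_(y in D) g y)%E.
Proof.
move=> mD mg g0.
rewrite -(ge0_integral_pushforward measurable_common_image)//.
- by apply: eq_measure_integral => B mB _; exact: common_image_law.
- exact: measurable_funTS.
Qed.

Let is_cond_prob_common_image (G : set Omega) (h : path_space zC -> R) :
  measurable_fun setT h -> (forall y, 0 <= h y <= 1) ->
  (forall D : set (path_space zC), measurable D ->
    (\int[nu]_(y in D) (h y)%:E =
    Q (G `&` trajectory common_image @^-1` D))%E) ->
  is_cond_prob Q (sigma_of common_image) G (h \o trajectory common_image).
Proof.
move=> mh h01 hG; split.
- move=> B mB; exists (h @^-1` B); last by rewrite setTI.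
  exact: (measurable_preimage mh mB).
- apply: (integrable_01 Q (g := h \o trajectory common_image)) => [|u].
    exact: (measurableT_comp mh measurable_common_image).
  exact: h01.
move=> _ [D mD <-]; rewrite setTI -hG//.
rewrite -(integral_common_image (g := EFin \o h))//.
- exact/measurable_EFinP.
- by move=> y; rewrite lee_fin; case/andP: (h01 y).
Qed.

(** The densities, evaluated along the common image, are versions of the
    conditional probabilities.  An event [D] of the common image is the same
    event of the image of every component, so integrating over [D] amounts to
    restricting all sides of a rectangle to the preimage of [D]. *)
Lemma component_cond_independent : cond_independent Q component common_image.
Proof.
move=> B mB.
have mB' i : measurable (B i : set (path_space (xA i))) by exact: mB.
have md i := measurable_cond_density mF rhoF (B i : set (path_space (xA i))).
exists (fun i => density (B i) \o trajectory common_image); split => [i|].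
- apply: is_cond_prob_common_image.
  + exact: md.
  + by move=> y; rewrite cond_density_ge0 cond_density_le1.
  move=> D mD; rewrite (integral_cond_density mF rhoF (mB' i) mD).
  rewrite -component_marginal; last first.
    by apply: measurableI => //; exact: (measurable_preimage (mF i) mD).
  congr (Q _); apply/seteqP.
  by split => u /= [Bu Du]; split => //; move: Du; rewrite (trajectory_image i).
pose psi (y : path_space zC) := \prod_(i < k) density (B i) y.
change (is_cond_prob Q (sigma_of common_image)
  (\bigcap_(i in [set: 'I_k]) trajectory (component i) @^-1` B i)
  (psi \o trajectory common_image)).
apply: is_cond_prob_common_image.
- apply: (measurable_prod (s := index_enum _)
    (h := fun i (y : path_space zC) => density (B i) y)) => i _.
  exact: md.
- move=> y; rewrite /psi prodr_ge0/=; last first.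
    by move=> i _; exact: cond_density_ge0.
  by apply: prodr_ile1 => i _; rewrite cond_density_ge0 cond_density_le1.
move=> D mD; have k0 : (0 < k)%N by apply: leq_ltn_trans (ltn_ord i0).
rewrite -(coupling_mass_cond mF rhoF k0 mB' mD) -component_law; last first.
  by move=> i; apply: measurableI => //; exact: (measurable_preimage (mF i) mD).
congr (Q _); apply/seteqP; split => u.
  move=> h; split => [i _|]; first by case: (h i I).
  by rewrite /= (trajectory_image i0); case: (h i0 I).
move=> [h Du] i _; split; first exact: h.
by move: Du; rewrite /= (trajectory_image i).
Qed.

End realization.
End markov_coupling.

Theorem corollary5 (R : realType) (k : nat) (hk : (1 <= k)%N)
    (A : 'I_k -> countType) (C : countType) (f : forall i : 'I_k, A i -> C)
    (d : 'I_k -> measure_display)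
    (Omega : forall i : 'I_k, measurableType (d i))
    (P : forall i : 'I_k, probability (Omega i) R)
    (Xbar : forall i : 'I_k, nat -> Omega i -> A i)
    (dZ : measure_display) (OmegaZ : measurableType dZ)
    (PZ : probability OmegaZ R) (Zbar : nat -> OmegaZ -> C)
    (hX : forall i : 'I_k, homogeneous_markov_chain (P i) (Xbar i))
    (hZ : homogeneous_markov_chain PZ Zbar)
    (hf : forall i : 'I_k,
        eq_law (P i) PZ (fun t w => f i (Xbar i t w)) Zbar) :
  exists (d' : measure_display) (Omega' : measurableType d')
      (Q : probability Omega' R)
      (X : forall i : 'I_k, nat -> Omega' -> A i) (Z : nat -> Omega' -> C),
    homogeneous_markov_chain Q (joint X) /\
    (forall i : 'I_k, eq_law Q (P i) (X i) (Xbar i)) /\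
    (forall (i j : 'I_k) (t : nat) (w : Omega'),
        f i (X i t w) = f j (X j t w)) /\
    (forall (i : 'I_k) (t : nat) (w : Omega'), Z t w = f i (X i t w)) /\
    eq_law Q PZ Z Zbar /\
    cond_independent Q X Z.
Proof.
have pX i : process (Xbar i) by have [mu [p []]] := hX i.
have pZ : process Zbar by have [mu [p []]] := hZ.
pose xA i := trajectory (Xbar i) point.
pose zC := trajectory Zbar point.
pose rho i := path_law (P i) (xA i) (pX i).
pose nu := path_law PZ zC pZ.
pose i0 : 'I_k := Ordinal hk.
have rhoF i D :
    measurable D -> rho i (@path_image k A C f xA zC i @^-1` D) = nu D.
  by move=> mD; exact: (hf i D mD).
have rhoM i : markov_law (rho i) by exact: markov_law_chain.
have nuM : markov_law nu by exact: markov_law_chain.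
have [dQ [OmegaQ [Q [Y [pY QY Ypos]]]]] := process_of_fdd
  (word_mass_ge0 rhoF i0) (word_mass_nil rhoF i0) (word_mass_sum rhoF i0).
have imageE i t u := component_image i0 Ypos i t u.
exists dQ, OmegaQ, Q, (component Y), (common_image f i0 Y).
split; first exact: (coupled_chain_markov nuM rhoM i0 pY QY).
split => [i B mB|]; first exact: (component_marginal i0 pY QY mB).
split => [i j t u|]; first by rewrite -!imageE.
split => [i t u|]; first exact: imageE.
split => [B mB|]; first exact: (common_image_law i0 pY QY mB).
exact: (component_cond_independent i0 pY QY Ypos).
Qed.
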